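(* Let $n\ge2$, let $m\ge0$ be an integer, $q>2m+3$, $\alpha=\frac{q-3-2m}{q-1}\in(0,1)$, $v(x_1)=\operatorname{sign}(x_1)|x_1|^\alpha$ on $(-1,1)$, and $\Theta_1(x_1,p_1)=-\arctan\left((1-\alpha)\alpha^{1-q}x_1^{2m+1}p_1^q\right)$. For any $a_2,\dots,a_n\in\mathbb{R}$, the function $$u(x_1,\dots,x_n)=v(x_1)+\sum_{i=2}^n\frac{a_i x_i^2}{2}$$ on $\{|x_1|<1\}\subset\mathbb{R}^n$ is a non-Lipschitz viscosity solution of $$\sum_{i=1}^n\arctan\lambda_i(D^2u)=\Theta_1(x_1,u_{x_1})+\sum_{i=2}^n\arctan a_i=:\Theta(x,Du).$$ Moreover, for every choice of $a_2,\dots,a_n$, the total phase $\Theta(x,Du)$ attains subcritical values, i.e. values less than $(n-2)\frac{\pi}{2}$. Consequently the condition $\Theta(x,u,Du)\ge(n-2)\frac{\pi}{2}$ cannot be dropped from an interior gradient estimate.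
   Context: $\lambda_i(M)$ are the eigenvalues of a symmetric matrix $M$. A continuous function $u$ is a viscosity solution of $\sum_i\arctan\lambda_i(D^2u)=\Theta(x,u,Du)$ on an open set if, for every $x_0$ and every $C^2$ function $\varphi$ near $x_0$ with $\varphi(x_0)=u(x_0)$: if $\varphi\ge u$ near $x_0$ then $\sum_i\arctan\lambda_i(D^2\varphi(x_0))\ge\Theta(x_0,u(x_0),D\varphi(x_0))$, and if $\varphi\le u$ near $x_0$ then the reverse inequality $\le$ holds. The formula for $\Theta_1$ is used for $p_1>0$ and may be extended arbitrarily to $p_1\le0$ when $p_1^q$ is not defined there. $\Theta(x,Du)$ is evaluated at points with $x_1\ne0$, where $u$ is smooth. The interior gradient estimate referred to is the bound $|Du(0)|\le C\left(1+(\operatorname{osc}_{B_1}u)^2\right)$ for solutions of $\sum_i\arctan\lambda_i(D^2u)=\Theta(x,u,Du)$ on the unit ball $B_1$. *)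

(* Defs.v *)
From HB Require Import structures.
From mathcomp Require Import all_boot all_order all_algebra.
From mathcomp Require Import all_classical all_reals all_analysis.

Set Implicit Arguments.
Unset Strict Implicit.
Unset Printing Implicit Defensive.

Import Order.TTheory GRing.Theory Num.Theory.
Import numFieldNormedType.Exports.
Local Open Scope classical_set_scope.
Local Open Scope ring_scope.

(* The norm of the library on 'rV[R]_n is the sup norm, hence a separate
   Euclidean norm; both induce the same topology, so nbhs, continuity and
   differentiability are the library's. *)
Definition enorm (R : realType) (n : nat) (x : 'rV[R]_n) : R :=
  Num.sqrt (\sum_i x 0 i ^+ 2).

Definition eball (R : realType) (n : nat) (r : R) : set 'rV[R]_n :=
  [set x | enorm x < r].

Definition partial (R : realType) (n : nat) (i : 'I_n) (f : 'rV[R]_n -> R) :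
  'rV[R]_n -> R := 'D_(delta_mx 0 i) f.

Definition grad (R : realType) (n : nat) (f : 'rV[R]_n -> R) (x : 'rV[R]_n) :
  'rV[R]_n := \row_i partial i f x.

Definition hessian (R : realType) (n : nat) (f : 'rV[R]_n -> R)
  (x : 'rV[R]_n) : 'M[R]_n := \matrix_(i, j) partial j (partial i f) x.

(* The pointwise condition; f is C^2 on an open set U when this holds at every
   point of U. *)
Definition c2_at (R : realType) (n : nat) (f : 'rV[R]_n -> R) (x : 'rV[R]_n) :
  Prop :=
  [/\ {for x, continuous f},
      forall i, derivable f x (delta_mx 0 i) /\
                {for x, continuous (partial i f)}
    & forall i j, derivable (partial i f) x (delta_mx 0 j) /\
                  {for x, continuous (partial j (partial i f))}].

(* Real eigenvalues with multiplicity, in nonincreasing order.  The sequence is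
   unique when the characteristic polynomial splits over R, in particular for
   symmetric M; otherwise the value is the irrelevant default [::]. *)
Definition eigenvalues (R : realType) (n : nat) (M : 'M[R]_n) : seq R :=
  xget [::] [set s | sorted >=%R s /\
                     char_poly M = \prod_(a <- s) ('X - a%:P)].

Definition arctan_trace (R : realType) (n : nat) (M : 'M[R]_n) : R :=
  \sum_(a <- eigenvalues M) atan a.

Definition viscosity_solution (R : realType) (n : nat)
  (Theta : 'rV[R]_n -> R -> 'rV[R]_n -> R) (Omega : set 'rV[R]_n)
  (u : 'rV[R]_n -> R) : Prop :=
  (forall x, Omega x -> {for x, continuous u}) /\
  (forall x0, Omega x0 -> forall phi : 'rV[R]_n -> R,
     (\forall x \near x0, c2_at phi x) -> phi x0 = u x0 ->
     ((\forall x \near x0, u x <= phi x) ->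
        Theta x0 (u x0) (grad phi x0) <= arctan_trace (hessian phi x0)) /\
     ((\forall x \near x0, phi x <= u x) ->
        arctan_trace (hessian phi x0) <= Theta x0 (u x0) (grad phi x0))).

(* Extended-real valued: +oo when w is unbounded on A. *)
Definition osc (R : realType) (n : nat) (A : set 'rV[R]_n)
  (w : 'rV[R]_n -> R) : \bar R :=
  (ereal_sup [set (w x)%:E | x in A] - ereal_inf [set (w x)%:E | x in A])%E.

(* The estimate is only required of C^2 solutions, for which Du(0) is
   meaningful.  This is the weakest form of the estimate, so that its failure
   entails the failure for any larger class of solutions. *)
Definition interior_gradient_estimate (R : realType) (n : nat)
  (Theta : 'rV[R]_n -> R -> 'rV[R]_n -> R) (C : R) : Prop :=
  forall w : 'rV[R]_n -> R,
    (forall x, eball 1 x -> c2_at w x) ->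
    viscosity_solution Theta (eball 1) w ->
    ((enorm (grad w 0))%:E <= C%:E * (1 + osc (eball 1) w ^+ 2))%E.

Definition idx1 (n : nat) (hn : (2 <= n)%N) : 'I_n := Ordinal (ltnW hn).

Definition slab (R : realType) (n : nat) (i1 : 'I_n) : set 'rV[R]_n :=
  [set x | `|x 0 i1| < 1].

Definition expo (R : realType) (m : nat) (q : R) : R :=
  (q - 3 - 2 * m%:R) / (q - 1).

Definition profile (R : realType) (m : nat) (q : R) (x1 : R) : R :=
  Num.sg x1 * `|x1| `^ expo m q.

Definition phase1 (R : realType) (m : nat) (q x1 p1 : R) : R :=
  - atan ((1 - expo m q) * expo m q `^ (1 - q) * x1 ^+ (2 * m + 1) * p1 `^ q).

Definition example_fun (R : realType) (n : nat) (i1 : 'I_n) (m : nat) (q : R)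
  (a : 'I_n -> R) (x : 'rV[R]_n) : R :=
  profile m q (x 0 i1) + \sum_(i < n | i != i1) a i * x 0 i ^+ 2 / 2.

Definition total_phase (R : realType) (n : nat) (i1 : 'I_n)
  (Theta1 : R -> R -> R) (a : 'I_n -> R) (x : 'rV[R]_n) (z : R)
  (p : 'rV[R]_n) : R :=
  Theta1 (x 0 i1) (p 0 i1) + \sum_(i < n | i != i1) atan (a i).

(* Main.v *)
Require Import Defs.
From HB Require Import structures.
From mathcomp Require Import all_boot all_order all_algebra.
From mathcomp Require Import sesquilinear spectral complex.
From mathcomp Require Import all_classical all_reals all_analysis.
From mathcomp Require Import ring lra zify.

Set Implicit Arguments.
Unset Strict Implicit.
Unset Printing Implicit Defensive.

Import Order.TTheory GRing.Theory Num.Theory.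
Import numFieldNormedType.Exports.
Local Open Scope classical_set_scope.
Local Open Scope ring_scope.

(* At a point where u is smooth, a C^2 function touching u there has the same
   gradient and an ordered Hessian, so Weyl's inequalities for the eigenvalues
   make the classical solution a viscosity solution. On {x_1 = 0} the profile
   has a vertical tangent, so no differentiable function touches u from either
   side and the viscosity conditions are vacuous. The same vertical tangent
   destroys the Lipschitz property, and v'' -> -oo as x_1 -> 0+ drives
   arctan v'' to -pi/2, which yields the subcritical values.

   The ODE v'' = -c x^(2m+1) (v')^q behind the equation is separable:
   (v')^(1-q) = al^(1-q) x^(2m+2) + d, with d = 0 for the singular profile. For
   d > 0 the solutions are smooth, bounded by the singular profile, and have
   slope d^(-1/(q-1)) at 0, which is unbounded as d -> 0. *)

(** * Weyl monotonicity of the arctangent trace *)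

(** The exponent comes from balancing powers: [sign(x)|x|^al] can solve [v'' = -c x^(2m+1) (v')^q]
    only if [al - 2 = 2m + 1 + q (al - 1)], whose solution is [expo m q]; [q > 2m+3] makes it
    positive, so that the profile is continuous at 0. The power [2m+1] is odd, so [v''] changes sign
    across 0 while [v'] stays positive on both sides; gradients thus remain where [Theta1] is
    prescribed.

    The singular solution cannot itself refute the gradient estimate, which is asked of C^2
    solutions only. The smooth family can, because [d] is an integration constant: it does not enter
    [Theta], so one constant [C] would have to serve every [d].

    Two definitions shape the tools. [c2_at] speaks of continuous partial derivatives, so functions
    are compared on lines through the touching point, where one-variable tests apply. [eigenvalues]
    is a list of roots of the characteristic polynomial, so Weyl's inequalities are obtained by
    counting the roots above each threshold, and sorted lists are then compared entry by entry. *)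

Section weyl.
Local Open Scope sesquilinear_scope.

Lemma rowsub_unitarymx (C : numClosedFieldType) k n (P : 'M[C]_n)
    (f : 'I_k -> 'I_n) :
  injective f -> P \is unitarymx -> rowsub f P \is unitarymx.
Proof.
move=> f_inj /row_unitarymxP P_unitary; apply/row_unitarymxP => i j.
by rewrite !row_rowsub P_unitary (inj_eq f_inj).
Qed.

(** The rows of [P] are orthonormal eigenvectors, and on the span of those selected by [f] the form
    is still diagonal. Its Rayleigh quotients there are weighted averages of the selected
    eigenvalues, which can be compared with a threshold. *)
Lemma diag_form_rowsub (C : numClosedFieldType) k n (P : 'M[C]_n)
    (d : 'rV[C]_n) (f : 'I_k -> 'I_n) (w : 'rV[C]_k) :
  injective f -> P \is unitarymx ->
  let v := w *m rowsub f P in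
  (v *m (invmx P *m diag_mx d *m P) *m v^t*) 0 0 =
    \sum_i d 0 (f i) * `|w 0 i| ^+ 2.
Proof.
move=> f_inj P_unitary v.
have Pf : rowsub f P *m invmx P = rowsub f 1%:M.
  by rewrite mul_rowsub_mx mulmxV ?unitarymx_unit.
have vP : v *m invmx P = w *m rowsub f 1%:M by rewrite -mulmxA Pf.
have Pv : P *m v^t* = (w *m rowsub f 1%:M)^t*.
  rewrite -vP invmx_unitary // (trmx_mul v) map_mxM; congr (_ *m _).
  by rewrite map_trmx trmxK -map_mx_comp map_mx_id // => x; exact: conjCK.
set x := w *m rowsub f 1%:M in vP Pv.
have xE i : x 0 i = \sum_j w 0 j * (f j == i)%:R.
  by rewrite mxE; apply: eq_bigr => j _; rewrite !mxE.
have xf i : x 0 (f i) = w 0 i.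
  rewrite xE (bigD1 i) //= eqxx mulr1 big1 ?addr0 // => j ji.
  by rewrite (inj_eq f_inj) (negPf ji) mulr0.
have xNf i : i \notin codom f -> x 0 i = 0.
  move=> Ni; rewrite xE big1 // => j _; case: eqP => [E|]; last by rewrite mulr0.
  by rewrite -E codom_f in Ni.
have -> : v *m (invmx P *m diag_mx d *m P) *m v^t* = x *m diag_mx d *m x^t*.
  by rewrite !mulmxA vP -!mulmxA Pv.
rewrite mxE (bigID (mem (codom f))) /= [X in _ + X]big1 ?addr0; last first.
  by move=> i /xNf xi0; rewrite mul_mx_diag mxE xi0 !mul0r.
rewrite -big_uniq ?big_image /=; last by apply/injectiveP.
apply: eq_bigr => i _; rewrite mul_mx_diag mxE [x^t* _ _]mxE [x^T _ _]mxE xf.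
by rewrite mulrAC -normCK mulrC.
Qed.

Lemma unitary_form_rowsub (C : numClosedFieldType) k n (P : 'M[C]_n)
    (f : 'I_k -> 'I_n) (w : 'rV[C]_k) :
  injective f -> P \is unitarymx ->
  let v := w *m rowsub f P in
  (v *m v^t*) 0 0 = \sum_i `|w 0 i| ^+ 2.
Proof.
move=> f_inj P_unitary v.
have := diag_form_rowsub (const_mx 1) w f_inj P_unitary.
rewrite /= diag_const_mx mulmx1 mulVmx ?unitarymx_unit // mulmx1 => ->.
by apply: eq_bigr => i _; rewrite mxE mul1r.
Qed.

(* Weyl's inequalities in counting form: otherwise the span of the eigenvectors
   of A for eigenvalues >= t would meet that of the eigenvectors of B for
   eigenvalues < t, by dimension. *)
Lemma card_eigenvalues_ge_mono (C : numClosedFieldType) n (A B P Q : 'M[C]_n)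
    (d e : 'rV[C]_n) (t : C) :
  P \is unitarymx -> Q \is unitarymx ->
  A = invmx P *m diag_mx d *m P -> B = invmx Q *m diag_mx e *m Q ->
  (forall i, d 0 i \is Num.real) -> (forall i, e 0 i \is Num.real) ->
  t \is Num.real ->
  (forall v : 'rV[C]_n, (v *m A *m v^t*) 0 0 <= (v *m B *m v^t*) 0 0) ->
  (#|[pred i | (t <= d 0 i)%R]| <= #|[pred i | (t <= e 0 i)%R]|)%N.
Proof.
move=> uP uQ -> -> d_real e_real t_real leAB; rewrite leqNgt; apply/negP.
set S := [pred i | t <= d 0 i]; set T := [pred i | t <= e 0 i] => ltTS.
pose f : 'I_#|S| -> 'I_n := enum_val; pose g : 'I_#|[predC T]| -> 'I_n := enum_val.
have [f_inj g_inj] : injective f /\ injective g by split; apply: enum_val_inj.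
have cardTC : (#|T| + #|[predC T]| = n)%N.
  by rewrite -[RHS]card_ord -(cardC T); congr (_ + _)%N; apply: eq_card.
pose U := rowsub f P; pose V := rowsub g Q.
have : (U :&: V)%MS != 0.
  rewrite -mxrank_eq0 -lt0n; have := mxrank_sum_cap U V.
  rewrite (mxrank_unitary (rowsub_unitarymx f_inj uP)).
  rewrite (mxrank_unitary (rowsub_unitarymx g_inj uQ)).
  have := rank_leq_col (U + V)%MS; have := cardTC.
  by move: ltTS; rewrite -/U -/V; lia.
case/rowV0Pn => v; rewrite sub_capmx => /andP[/submxP[x vx] /submxP[y vy]] v0.
have vv : 0 < (v *m v^t*) 0 0.
  rewrite mxE; under eq_bigr do rewrite mxE mxE -normCK.
  have [i vi] : exists i, v 0 i != 0 by apply/rV0Pn.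
  rewrite (bigD1 i) //= ltr_wpDr ?exprn_gt0 ?normr_gt0 //.
  by apply: sumr_ge0 => j _; rewrite exprn_ge0.
have leA : t * (v *m v^t*) 0 0 <= (v *m (invmx P *m diag_mx d *m P) *m v^t*) 0 0.
  rewrite vx diag_form_rowsub // unitary_form_rowsub // mulr_sumr.
  apply: ler_sum => i _; rewrite ler_wpM2r ?exprn_ge0 //.
  by have := enum_valP i; rewrite inE.
have ltB : (v *m (invmx Q *m diag_mx e *m Q) *m v^t*) 0 0 < t * (v *m v^t*) 0 0.
  have e_lt i : e 0 (g i) < t.
    have := enum_valP i; rewrite !inE.
    by rewrite (real_ltNge (e_real _) t_real).
  move: vv; rewrite vy diag_form_rowsub // unitary_form_rowsub // => vv.
  rewrite -subr_gt0 mulr_sumr -sumrB.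
  have ge0 i : 0 <= t * `|y 0 i| ^+ 2 - e 0 (g i) * `|y 0 i| ^+ 2.
    by rewrite -mulrBl mulr_ge0 ?exprn_ge0 // subr_ge0 ltW.
  (* Strictness: if the nonnegative gaps summed to 0, each would vanish, and [e 0 (g i) < t] would
     force every coordinate of [y] to be 0, against [0 < |v|^2]. *)
  rewrite lt_def sumr_ge0 // andbT; apply: contraL vv => /eqP.
  move=> /(psumr_eq0P (fun i _ => ge0 i)) y0.
  rewrite big1 ?ltxx // => i _; apply/eqP; have /eqP := y0 i isT.
  by rewrite -mulrBl mulf_eq0 subr_eq0 gt_eqF.
by have := lt_le_trans ltB (le_trans leA (leAB v)); rewrite ltxx.
Qed.

Lemma char_poly_conj (F : fieldType) n (P A : 'M[F]_n) : P \in unitmx ->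
  char_poly (invmx P *m A *m P) = char_poly A.
Proof.
move=> P_unit; rewrite /char_poly /char_poly_mx.
have PP : map_mx polyC (invmx P) *m map_mx polyC P = 1%:M.
  by rewrite -map_mxM mulVmx // map_mx1.
have -> : 'X%:M - map_mx polyC (invmx P *m A *m P) =
    map_mx polyC (invmx P) *m ('X%:M - map_mx polyC A) *m map_mx polyC P.
  by rewrite mulmxBr mulmxBl !map_mxM scalar_mxC -[_%:M *m _ *m _]mulmxA PP mulmx1.
by rewrite !det_mulmx mulrAC -det_mulmx PP det1 mul1r.
Qed.

Lemma char_poly_diag (F : fieldType) n (d : 'rV[F]_n) :
  char_poly (diag_mx d) = \prod_i ('X - (d 0 i)%:P).
Proof.
rewrite char_poly_trig ?diag_mx_is_trig //.
by apply: eq_bigr => i _; rewrite mxE eqxx.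
Qed.

Local Notation toC R := (real_complex R).

(** Over [R[i]] the matrix becomes hermitian, so it is unitarily diagonalizable with real spectrum,
    and the diagonal descends to [R]. *)
Lemma symmetric_spectral (R : rcfType) n (M : 'M[R]_n) : M^T = M ->
  exists2 P : 'M[R[i]]_n, P \is unitarymx &
  exists d : 'rV[R]_n,
    map_mx (toC R) M = invmx P *m diag_mx (map_mx (toC R) d) *m P.
Proof.
move=> symM; set A := map_mx _ M.
have herm : A \is hermsymmx.
  apply/is_hermitianmxP; rewrite expr0 scale1r; apply/matrixP => i j.
  by rewrite !mxE -[in LHS]symM mxE conj_Creal //; apply/complex_realP; eexists.
exists (spectralmx A); first exact: spectral_unitarymx.
exists (\row_i complex.Re (spectral_diag A 0 i)).
have -> : map_mx (toC R) (\row_i complex.Re (spectral_diag A 0 i)) = spectral_diag A.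
  apply/rowP => i; rewrite !mxE RRe_real //.
  by have /mxOverP := hermitian_spectral_diag_real herm.
exact/orthomx_spectralP/hermitian_normalmx.
Qed.

(** The factorization over [R[i]] has real roots and pulls back along the injection of polynomials.
    Splitting over [R] is what gives [eigenvalues M] its intended meaning. *)
Lemma symmetric_char_poly (R : rcfType) n (M : 'M[R]_n) (P : 'M[R[i]]_n)
    (d : 'rV[R]_n) : P \in unitmx ->
  map_mx (toC R) M = invmx P *m diag_mx (map_mx (toC R) d) *m P ->
  char_poly M = \prod_i ('X - (d 0 i)%:P).
Proof.
move=> P_unit E; apply: (map_poly_inj (toC R)).
rewrite map_char_poly E char_poly_conj // char_poly_diag rmorph_prod.
by apply: eq_bigr => i _; rewrite mxE rmorphB /= map_polyX map_polyC.
Qed.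

(** For [v = a + ib] the cross terms cancel by symmetry of the matrix, so the hermitian form at [v]
    is the sum of the real forms at [a] and [b]. *)
Lemma real_form_le (R : rcfType) n (A B : 'M[R]_n) : A^T = A -> B^T = B ->
  (forall x : 'rV[R]_n, (x *m A *m x^T) 0 0 <= (x *m B *m x^T) 0 0) ->
  forall v : 'rV[R[i]]_n,
    (v *m map_mx (toC R) A *m v^t*) 0 0 <= (v *m map_mx (toC R) B *m v^t*) 0 0.
Proof.
move=> symA symB leAB v.
pose a := map_mx (@complex.Re R) v; pose b := map_mx (@complex.Im R) v.
have formE (K : 'M[R]_n) : K^T = K ->
  (v *m map_mx (toC R) K *m v^t*) 0 0 =
    toC R ((a *m K *m a^T) 0 0 + (b *m K *m b^T) 0 0).
  move=> symK.
  have vE : v = map_mx (toC R) a + 'i%C *: map_mx (toC R) b.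
    by apply/rowP => i; rewrite !mxE; case: (v 0 i) => x y; simpc.
  have vtE : v^t* = map_mx (toC R) a^T - 'i%C *: map_mx (toC R) b^T.
    by apply/colP => i; rewrite !mxE; case: (v 0 i) => x y; simpc.
  have abE : a *m K *m b^T = b *m K *m a^T.
    rewrite [LHS]mx11_scalar -tr_scalar_mx -mx11_scalar.
    by rewrite !trmx_mul trmxK symK mulmxA.
  rewrite vtE [in LHS]vE !mulmxDl !mulmxBr -!scalemxAl -!scalemxAr -!map_mxM abE.
  rewrite scalerA -expr2 sqr_i scaleN1r opprK addrA subrK.
  by rewrite -map_mxD [LHS]mxE; congr (toC R _); rewrite [LHS]mxE.
rewrite !formE // lecR.
exact: lerD (leAB a) (leAB b).
Qed.

(** The count at the threshold [a], the head of [s1], forces [a <= b]. The hypothesis passes to the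
    tails: for [t <= a] both heads are counted, and for [t > a] nothing in [s1] is. *)
Lemma ler_sum_sorted (R : realDomainType) (f : R -> R) (s1 s2 : seq R) :
  {homo f : x y / x <= y} -> sorted >=%R s1 -> sorted >=%R s2 ->
  size s1 = size s2 ->
  (forall t, (count (>= t) s1 <= count (>= t) s2)%N) ->
  \sum_(x <- s1) f x <= \sum_(x <- s2) f x.
Proof.
move=> f_homo; elim: s1 s2 => [|a s1 IH] [|b s2] //.
move=> ss1 ss2 [sz] le_count.
have s1_le : all (<= a) s1.
  by apply: order_path_min ss1 => x y z /= xy yz; apply: le_trans yz xy.
have s2_le : all (<= b) s2.
  by apply: order_path_min ss2 => x y z /= xy yz; apply: le_trans yz xy.
have le_ab : a <= b.
  have := le_count a; rewrite /= lexx; case: (lerP a b) => // lt_ba.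
  rewrite add0n (_ : count _ s2 = 0%N) //; apply/eqP; rewrite -leqn0 leqNgt -has_count.
  apply/hasPn => x xs; rewrite -ltNge (le_lt_trans _ lt_ba) //; exact: (allP s2_le).
rewrite !big_cons lerD ?f_homo // IH ?(path_sorted ss1) ?(path_sorted ss2) //.
move=> t; have := le_count t; rewrite /=.
case: (lerP t a) => [ta|ta _]; first by rewrite (le_trans ta le_ab) leq_add2l.
rewrite (_ : count _ s1 = 0%N) //; apply/eqP; rewrite -leqn0 leqNgt -has_count.
apply/hasPn => x xs; rewrite -ltNge (le_lt_trans _ ta) //; exact: (allP s1_le).
Qed.

Section eigenvalues.
Variable R : realType.

(** The sorted list of the [d 0 i] is a witness, which excludes the default [[::]]; unique
    factorization then determines the list up to permutation. *)
Lemma eigenvalues_char_poly n (M : 'M[R]_n) (d : 'rV[R]_n) :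
  char_poly M = \prod_i ('X - (d 0 i)%:P) ->
  sorted >=%R (eigenvalues M) /\
  perm_eq (eigenvalues M) [seq d 0 i | i <- enum 'I_n].
Proof.
move=> Md; set s := [seq d 0 i | i <- enum 'I_n].
have prod_s : \prod_(a <- s) ('X - a%:P) = \prod_i ('X - (d 0 i)%:P).
  by rewrite big_map big_enum.
pose S := [set s | sorted >=%R s /\ char_poly M = \prod_(a <- s) ('X - a%:P)].
have [] : S (eigenvalues M).
  apply: (@xgetPex _ [::] S); exists (sort >=%R s); split.
    by apply: sort_sorted => x y /=; apply: le_total.
  by rewrite Md -prod_s; apply/perm_big; rewrite perm_sym; apply/permPl/perm_sort.
move=> sM; rewrite Md -prod_s => /prod_XsubC_eq; rewrite perm_sym.
by split.
Qed.

Lemma arctan_trace_char_poly n (M : 'M[R]_n) (d : 'rV[R]_n) :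
  char_poly M = \prod_i ('X - (d 0 i)%:P) ->
  arctan_trace M = \sum_i atan (d 0 i).
Proof.
move=> /eigenvalues_char_poly[_ Md].
by rewrite /arctan_trace (perm_big _ Md) big_map big_enum.
Qed.

Lemma arctan_trace_diag n (d : 'rV[R]_n) :
  arctan_trace (diag_mx d) = \sum_i atan (d 0 i).
Proof. exact/arctan_trace_char_poly/char_poly_diag. Qed.

(** Ellipticity of the operator. Apart from the value on diagonal matrices, this is all that the
    viscosity argument uses about [arctan_trace]. *)
Lemma arctan_trace_mono n (A B : 'M[R]_n) : A^T = A -> B^T = B ->
  (forall x : 'rV[R]_n, (x *m A *m x^T) 0 0 <= (x *m B *m x^T) 0 0) ->
  arctan_trace A <= arctan_trace B.
Proof.
move=> symA symB leAB.
have [P uP [d Ad]] := symmetric_spectral symA.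
have [Q uQ [e Be]] := symmetric_spectral symB.
have chA := symmetric_char_poly (unitarymx_unit uP) Ad.
have chB := symmetric_char_poly (unitarymx_unit uQ) Be.
have [sA pA] := eigenvalues_char_poly chA.
have [sB pB] := eigenvalues_char_poly chB.
apply: (ler_sum_sorted (@le_atan R) sA sB).
  by rewrite (perm_size pA) (perm_size pB) !size_map.
move=> t; rewrite (permP pA) (permP pB).
have creal (x : R) : toC R x \is Num.real by apply/complex_realP; exists x.
have cardE_ (c : 'rV[R]_n) : count (>= t) [seq c 0 i | i <- enum 'I_n] =
    #|[pred i | toC R t <= map_mx (toC R) c 0 i]|.
  rewrite count_map cardE size_filter -enumT; apply: eq_count => i.
  by rewrite /= inE /= mxE lecR.
rewrite !cardE_.
apply: (card_eigenvalues_ge_mono uP uQ Ad Be _ _ (creal t)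
  (real_form_le symA symB leAB)) => i; rewrite mxE; exact: creal.
Qed.

End eigenvalues.

End weyl.

(** * Second-order calculus in R^n *)

Lemma near_ballP (R : realType) (V : normedModType R) (x : V) (P : V -> Prop) :
  (\forall y \near x, P y) <->
  exists2 r : R, 0 < r & forall y, `|y - x| < r -> P y.
Proof.
split=> [/nbhs_normP[r /= r0 rP]|[r r0 rP]].
  by exists r => // y; rewrite distrC => yx; exact: rP.
by apply/nbhs_normP; exists r => // y /=; rewrite distrC; exact: rP.
Qed.

Section local_minimum.
Variables (R : realType) (k dk : R -> R).
Hypotheses (dkE : \forall t \near (0 : R), is_derive (t : R) 1 k (dk t))
  (k_min : \forall t \near (0 : R), k 0 <= k t).

Let near_itv : exists2 r : R, 0 < r & forall t : R, `|t| < r ->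
  is_derive t 1 k (dk t) /\ k 0 <= k t.
Proof.
have [r r0 rP] := (near_ballP _ _).1 (filterI dkE k_min).
by exists r => // t tr; apply: rP; rewrite subr0.
Qed.

Lemma local_min_derive0 : dk 0 = 0.
Proof.
have [r r0 rP] := near_itv.
have in_itv_norm t : t \in `]- r, r[ -> `|t| < r.
  by rewrite in_itv/= ltr_norml.
have [||||] := @derive1_at_min _ k (- r) r 0.
- by rewrite -subr_ge0 opprK addr_ge0 ?ltW.
- by move=> t /in_itv_norm/rP[[]].
- by rewrite in_itv/= oppr_lt0 r0.
- by move=> t /in_itv_norm/rP[].
move=> _ k0; have : `|0 : R| < r by rewrite normr0.
by case/rP => -[_ <-] _.
Qed.

(** If [c < 0], then [dk], which vanishes at 0, is negative just to the right of 0, and the mean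
    value theorem makes [k] drop below [k 0]. No second derivative away from 0 is required. *)
Lemma local_min_derive2_ge0 (c : R) : is_derive (0 : R) 1 dk c -> 0 <= c.
Proof.
move=> dkc; rewrite leNgt; apply/negP => c0.
have [r r0 rP] := near_itv.
have : h^-1 *: (dk (h *: 1 + 0) - dk 0) @[h --> 0^'] --> c.
  by case: dkc => dkc <-; exact: dkc.
move=> /cvgrPdist_lt/(_ (- c)); rewrite oppr_gt0 => /(_ c0).
rewrite near_withinE => /near_ballP[d d0 dP].
pose s := Num.min r d / 2.
have s0 : 0 < s by rewrite divr_gt0 // lt_min r0.
have [sr sd] : s < r /\ s < d.
  by apply/andP; rewrite -lt_min ltr_pdivrMr // ltr_pMr ?lt_min ?r0 // ltr1n.
have dk_lt0 t : 0 < t -> t < d -> dk t < 0.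
  move=> t0 td; have := dP t.
  rewrite subr0 gtr0_norm // => /(_ td (lt0r_neq0 t0)).
  rewrite [_ *: 1]mulr1 addr0 local_min_derive0 subr0 ltr_norml => /andP[+ _].
  by rewrite opprK ltrBrDl gtrDr [_ *: _]mulrC pmulr_llt0 ?invr_gt0.
have dk_itv (t : R) : t \in `]0, s[ -> is_derive t 1 k (dk t).
  rewrite in_itv/= => /andP[t0 ts].
  have tr : `|t| < r by rewrite gtr0_norm // (lt_trans ts).
  by case: (rP t tr).
have ck : {within `[0, s], continuous k}.
  apply: derivable_within_continuous => t; rewrite in_itv/= => /andP[t0 ts].
  have tr : `|t| < r by rewrite ger0_norm // (le_lt_trans ts).
  by have [[]] := rP t tr.
have [t] := MVT s0 dk_itv ck.
rewrite in_itv/= subr0 => /andP[t0 ts] kE.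
have [|_] := rP s; first by rewrite gtr0_norm.
by rewrite -subr_ge0 kE pmulr_lge0 // leNgt dk_lt0 // (lt_trans ts).
Qed.

End local_minimum.

(** * Directional derivatives, symmetry of the Hessian and touching functions *)

Section directional_derivatives.
Variables (R : realType) (n : nat).
Implicit Types (f : 'rV[R]_n -> R) (x v : 'rV[R]_n).

Local Notation e i := (delta_mx 0 i : 'rV[R]_n).

Lemma is_derive_cvg f x v (l : R) :
  h^-1 *: (f (h *: v + x) - f x) @[h --> 0^'] --> l -> is_derive x v f l.
Proof. by move=> fl; split; [exact: cvgP fl|exact: cvg_lim fl]. Qed.

Lemma is_derive_line f x v (t : R) (l : R) :
  is_derive (x + t *: v) v f l -> is_derive t 1 (fun s => f (x + s *: v)) l.
Proof.
move=> dfl; have E : (fun h : R => h^-1 *: (f (x + (h *: 1 + t) *: v) -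
      f (x + t *: v))) =
    (fun h : R => h^-1 *: (f (h *: v + (x + t *: v)) - f (x + t *: v))).
  by apply/funext => h; rewrite scalerDl /= [h *: 1]mulr1 addrCA.
split.
  by rewrite /derivable /= E; case: dfl.
by case: dfl => _ <-; rewrite /derive /= E.
Qed.

Lemma is_derive_translate f c x v (l : R) :
  is_derive (x + c) v f l -> is_derive x v (fun y => f (y + c)) l.
Proof.
have E : (fun h : R => h^-1 *: (f (h *: v + x + c) - f (x + c))) =
    (fun h : R => h^-1 *: (f (h *: v + (x + c)) - f (x + c))).
  by apply/funext => h; rewrite addrA.
case; rewrite /derivable /derive => d1 d2.
by split; rewrite /derivable /derive /= E.
Qed.

Lemma norm_delta_le1 i : `|e i| <= 1.
Proof.
rewrite [`|_|]mx_normrE; apply/bigmax_leP; split => // -[a b] _ /=.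
by rewrite mxE; case: (_ && _); rewrite ?normr1 ?normr0.
Qed.

Lemma partial_MVT f x i (s : R) :
  (forall t : R, `|t| <= `|s| -> derivable f (x + t *: e i) (e i)) ->
  exists2 t : R, `|t| <= `|s| &
    f (x + s *: e i) - f x = s * partial i f (x + t *: e i).
Proof.
move=> df; pose g t := f (x + t *: e i).
have dg (t : R) : `|t| <= `|s| -> is_derive t 1 g (partial i f (x + t *: e i)).
  by move=> ts; apply: is_derive_line; apply: derivableP; exact: df.
have cg (a b : R) : `|a| <= `|s| -> `|b| <= `|s| -> {within `[a, b], continuous g}.
  move=> la lb; apply: derivable_within_continuous => t.
  rewrite in_itv/= => /andP[at_ tb].
  have ts : `|t| <= `|s|.
    by rewrite ler_norml; move: la lb; rewrite !ler_norml => /andP[? ?] /andP[? ?]; lra.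
  by case: (dg t ts).
have g0 : g 0 = f x by rewrite /g scale0r addr0.
rewrite -g0 -/(g s); have [s0|s0|->] := ltrgtP s 0; last first.
- by exists 0; rewrite ?normr0 // subrr mul0r.
- have dg' t : t \in `]0, s[ -> is_derive t 1 g (partial i f (x + t *: e i)).
    by rewrite in_itv/= => /andP[t0 ts]; apply: dg; rewrite !gtr0_norm // ltW.
  have [|t] := MVT s0 dg'; first by apply: cg; rewrite ?normr0.
  rewrite in_itv/= subr0 mulrC => /andP[t0 ts] ->; exists t => //.
  by rewrite !gtr0_norm // ltW.
- have dg' t : t \in `]s, 0[ -> is_derive t 1 g (partial i f (x + t *: e i)).
    rewrite in_itv/= => /andP[t0 ts]; apply: dg.
    by rewrite !ltr0_norm // lerN2 ltW.
  have [|t] := MVT s0 dg'; first by apply: cg; rewrite ?normr0.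
  rewrite in_itv/= => /andP[st t0] E; exists t.
    by rewrite !ltr0_norm // lerN2 ltW.
  by rewrite -opprB E sub0r mulrN opprK mulrC.
Qed.

(** The difference quotient splits into the one along [v] and one along [e i] based at the moving
    point [h *: v + x]. The mean value theorem turns the latter into [c] times a value of
    [partial i f] near [x], and continuity at [x] gives the limit. *)
Lemma is_derive_add_coord f x v i (c l : R) :
  (\forall y \near x, derivable f y (e i)) -> {for x, continuous (partial i f)} ->
  is_derive x v f l -> is_derive x (v + c *: e i) f (l + c * partial i f x).
Proof.
move=> df cf dfl; apply: is_derive_cvg.
pose A (h : R) : R := h^-1 *: (f (h *: v + x) - f x).
pose B (h : R) : R := h^-1 *: (f (h *: (v + c *: e i) + x) - f (h *: v + x)).
have -> : (fun h : R => h^-1 *: (f (h *: (v + c *: e i) + x) - f x)) = A \+ B.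
  by apply/funext => h; rewrite /A /B /= -scalerDr; congr (_ *: _); ring.
apply: cvgD.
  by case: dfl => dfl <-; exact: dfl.
apply/cvgrPdist_le => eps eps0.
have eps'0 : 0 < eps / (`|c| + 1) by rewrite divr_gt0 // ltr_wpDl.
have [r r0 Hr] : exists2 r : R, 0 < r & forall y, `|y - x| < r ->
    derivable f y (e i) /\ `|partial i f x - partial i f y| <= eps / (`|c| + 1).
  apply/near_ballP; near=> y; split; first by near: y.
  by near: y; move/cvgrPdist_le : cf; apply.
near=> h.
have h0 : h != 0 by near: h; exact: nbhs_dnbhs_neq.
have hr : `|h| * (`|v| + `|c| + 1) < r.
  rewrite -ltr_pdivlMr ?ltr_wpDl //.
  by near: h; apply: dnbhs0_lt; rewrite divr_gt0 // ltr_wpDl.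
have close (t : R) : `|t| <= `|h * c| -> `|h *: v + x + t *: e i - x| < r.
  move=> tc; rewrite addrAC addrK; apply: le_lt_trans hr.
  rewrite (le_trans (ler_normD _ _)) // !normrZ -addrA mulrDr lerD2l.
  have := norm_delta_le1 i; have := normr_ge0 (e i); have := normr_ge0 t.
  move: tc; rewrite normrM; have := normr_ge0 h; nra.
have [|t tc Bt] := @partial_MVT f (h *: v + x) i (h * c).
  by move=> t /close /Hr [].
rewrite /B (scalerDr h) scalerA [h *: v + _ + x]addrAC Bt.
rewrite [_ *: _]mulrA mulKf // -mulrBr normrM.
have [_ /(ler_wpM2l (normr_ge0 c)) H] := Hr _ (close _ tc).
apply: le_trans H _; rewrite mulrCA ler_piMr ?(ltW eps0) //.
by rewrite ler_pdivrMr ?mul1r ?lerDl // ltr_wpDl.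
Unshelve. all: by end_near.
Qed.

Lemma is_derive_C1 f x v :
  (forall i, \forall y \near x, derivable f y (e i)) ->
  (forall i, {for x, continuous (partial i f)}) ->
  is_derive x v f (\sum_i v 0 i * partial i f x).
Proof.
move=> df cf; rewrite [v in is_derive _ v]row_sum_delta.
elim: (index_enum _) => [|i s IH].
  by rewrite !big_nil; exact: is_derive0.
by rewrite !big_cons addrC [X in is_derive _ _ _ X]addrC; exact: is_derive_add_coord.
Qed.

Lemma near_along_line (P : set 'rV[R]_n) x v :
  (\forall y \near x, P y) -> \forall t \near (0 : R), P (x + t *: v).
Proof.
move=> xP; apply: (_ : (fun t : R => x + t *: v) @ 0 --> x) xP.
rewrite -[X in _ --> X]addr0 -[X in _ + X](scale0r v).
by apply: cvgD; [exact: cvg_cst|apply: cvgZr_tmp; exact: cvg_id].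
Qed.

(** Its symmetry in [u] and [v] is the source of the symmetry of mixed derivatives. *)
Definition second_difference f x u v : R :=
  f (x + u + v) - f (x + u) - f (x + v) + f x.

Lemma second_differenceC f x u v :
  second_difference f x u v = second_difference f x v u.
Proof. by rewrite /second_difference [x + u + v]addrAC; ring. Qed.

Section C2.
Variables (f : 'rV[R]_n -> R) (x : 'rV[R]_n).
Hypothesis f_c2 : \forall y \near x, c2_at f y.

Lemma c2_near_is_derive : \forall y \near x, forall v,
  is_derive y v f (\sum_i v 0 i * partial i f y).
Proof.
have f_c2' := nbhs_interior f_c2; near=> y => v.
have yc2 : \forall z \near y, c2_at f z by near: y.
apply: is_derive_C1 => i.
  by apply: filterS yc2 => z [_ /(_ i)[]].
by have [_ /(_ i)[]] := nbhs_singleton yc2.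
Unshelve. all: by end_near.
Qed.

Lemma c2_is_derive_partial i v :
  is_derive x v (partial i f) (\sum_j v 0 j * partial j (partial i f) x).
Proof.
apply: is_derive_C1 => j; last first.
  by have [_ _ /(_ i j)[]] := nbhs_singleton f_c2.
by near=> y; have [_ _ /(_ i j)[]] : c2_at f y by near: y.
Unshelve. all: by end_near.
Qed.

(** Two mean value steps: along [e i] for [y |-> f (y + s *: e j) - f y], then along [e j] for
    [partial i f]. They give [s ^+ 2] times the mixed derivative at a point close to [x]. *)
Lemma second_difference_partial i j (eps : R) : 0 < eps -> \forall s \near 0^'+,
  `|second_difference f x (s *: e i) (s *: e j)
    - s ^+ 2 * partial j (partial i f) x| <= eps * s ^+ 2.
Proof.
move=> eps0.
have [r r0 Hr] : exists2 r : R, 0 < r & forall y, `|y - x| < r -> c2_at f y /\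
    `|partial j (partial i f) x - partial j (partial i f) y| <= eps.
  apply/near_ballP; near=> y; split; first by near: y.
  near: y; have [_ _ /(_ i j)[_ /cvgrPdist_le cf]] := nbhs_singleton f_c2.
  exact: cf.
near=> s; have s0 : 0 < s by near: s; exact: nbhs_right_gt.
have sr : s * 2 < r.
  by rewrite -ltr_pdivlMr //; near: s; apply: nbhs_right_lt; rewrite divr_gt0.
have close (a b : R) : `|a| <= s -> `|b| <= s ->
    `|x + a *: e i + b *: e j - x| < r.
  move=> sa sb; rewrite addrAC [_ - x]addrAC subrr add0r; apply: le_lt_trans sr.
  rewrite (le_trans (ler_normD _ _)) // !normrZ.
  have := norm_delta_le1 i; have := normr_ge0 (e i); have := normr_ge0 a.
  have := norm_delta_le1 j; have := normr_ge0 (e j); have := normr_ge0 b; nra.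
have close0 (a : R) : `|a| <= s -> `|x + a *: e i - x| < r.
  move=> sa; have := close a 0 sa.
  by rewrite normr0 scale0r addr0; apply; exact: ltW.
pose g y := f (y + s *: e j) - f y.
have dg (a : R) : `|a| <= s -> is_derive (x + a *: e i) (e i) g
    (partial i f (x + a *: e i + s *: e j) - partial i f (x + a *: e i)).
  move=> sa; apply: is_deriveB.
    apply: is_derive_translate; apply: derivableP.
    have [|[_ /(_ i)[]]] := Hr (x + a *: e i + s *: e j) _ => //.
    by apply: close; rewrite ?(gtr0_norm s0).
  by apply: derivableP; have [[_ /(_ i)[]]] := Hr _ (close0 _ sa).
have [t ts] : exists2 t : R, `|t| <= `|s| &
    g (x + s *: e i) - g x = s * partial i g (x + t *: e i).
  by apply: partial_MVT => t; rewrite (gtr0_norm s0) => /dg [].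
rewrite (gtr0_norm s0) in ts.
have -> : partial i g (x + t *: e i) =
    partial i f (x + t *: e i + s *: e j) - partial i f (x + t *: e i).
  by case: (dg _ ts).
have [t' t's ->] : exists2 t' : R, `|t'| <= `|s| &
    partial i f (x + t *: e i + s *: e j) - partial i f (x + t *: e i) =
    s * partial j (partial i f) (x + t *: e i + t' *: e j).
  apply: partial_MVT => t'; rewrite (gtr0_norm s0) => t's.
  by have [[_ _ /(_ i j)[]]] := Hr _ (close _ _ ts t's).
rewrite (gtr0_norm s0) in t's; rewrite /g => E.
rewrite (_ : second_difference _ _ _ _ =
    s * (s * partial j (partial i f) (x + t *: e i + t' *: e j))); last first.
  by rewrite -E /second_difference; ring.
rewrite mulrA -expr2 -mulrBr normrM ger0_norm ?sqr_ge0 // mulrC ler_wpM2r ?sqr_ge0 //.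
by rewrite distrC; have [] := Hr _ (close _ _ ts t's).
Unshelve. all: by end_near.
Qed.

End C2.

Section Schwarz.
Variables (f : 'rV[R]_n -> R) (x : 'rV[R]_n).
Hypothesis f_c2 : \forall y \near x, c2_at f y.

(** Both mixed derivatives approximate the same second difference divided by [s ^+ 2]. The symmetry
    makes Hessians eligible for the spectral comparison. *)
Lemma partialC i j : partial j (partial i f) x = partial i (partial j f) x.
Proof.
apply/eqP; rewrite -subr_eq0 -normr_eq0 eq_le normr_ge0 andbT.
apply/ler_addgt0Pl => eps eps0; rewrite addr0.
have eps2 : 0 < eps / 2 by rewrite divr_gt0.
have [s [[Hij Hji] s0]] := filter_ex (filterI (filterI
  (second_difference_partial f_c2 i j eps2)
  (second_difference_partial f_c2 j i eps2)) (nbhs_right_gt (0 : R))).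
rewrite second_differenceC in Hji.
have s20 : 0 < s ^+ 2 by rewrite exprn_gt0.
rewrite -(ler_pM2l s20) -[X in X * _ <= _]gtr0_norm // -normrM mulrBr.
rewrite (le_trans (ler_distD (second_difference f x (s *: e i) (s *: e j)) _ _)) //.
have -> : s ^+ 2 * eps = eps / 2 * s ^+ 2 + eps / 2 * s ^+ 2.
  by rewrite -mulrDl -splitr mulrC.
by apply: lerD; [rewrite distrC; exact: Hij|exact: Hji].
Qed.

Lemma hessian_sym : (hessian f x)^T = hessian f x.
Proof. by apply/matrixP => i j; rewrite !mxE partialC. Qed.

End Schwarz.

Section touching.
Variables (f u : 'rV[R]_n -> R) (x : 'rV[R]_n).
Hypotheses (f_c2 : \forall y \near x, c2_at f y)
  (u_c2 : \forall y \near x, c2_at u y)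
  (fu_x : f x = u x) (u_le_f : \forall y \near x, u y <= f y).

(** [dk v] is the derivative of [k v], the restriction of [f - u] to the line through [x] along [v].
    Touching makes 0 a local minimum of [k v]: the first-order test compares gradients, the
    second-order test Hessian forms. *)
Let dk v (t : R) := \sum_i v 0 i * partial i f (x + t *: v)
                  - \sum_i v 0 i * partial i u (x + t *: v).

Let k v (t : R) := f (x + t *: v) - u (x + t *: v).

Let is_derive_k v : \forall t \near (0 : R), is_derive (t : R) 1 (k v) (dk v t).
Proof.
have := near_along_line v (c2_near_is_derive f_c2).
have := near_along_line v (c2_near_is_derive u_c2).
apply: filterS2 => t du df.
by apply: is_deriveB; apply: is_derive_line.
Qed.

Let k_ge v : \forall t \near (0 : R), k v 0 <= k v t.
Proof.
have := near_along_line v u_le_f; apply: filterS => t ut.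
by rewrite /k scale0r addr0 fu_x subrr subr_ge0.
Qed.

Let is_derive_dk v : is_derive (0 : R) 1 (dk v)
  ((v *m hessian f x *m v^T) 0 0 - (v *m hessian u x *m v^T) 0 0).
Proof.
have dH g : (\forall y \near x, c2_at g y) -> is_derive (0 : R) 1
   (fun t : R => \sum_i v 0 i * partial i g (x + t *: v))
   ((v *m hessian g x *m v^T) 0 0).
  move=> g_c2.
  rewrite [X in is_derive _ _ X _](_ : _ = \sum_i (fun t : R =>
      v 0 i * partial i g (x + t *: v))); last first.
    by apply/funext => t; rewrite fct_sumE.
  have -> : (v *m hessian g x *m v^T) 0 0 =
      \sum_i v 0 i * (\sum_j v 0 j * partial j (partial i g) x).
    rewrite -mulmxA mxE; apply: eq_bigr => i _; congr (_ * _).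
    by rewrite mxE; apply: eq_bigr => j _; rewrite !mxE mulrC.
  apply: is_derive_sum => i; apply: is_deriveZ; apply: is_derive_line.
  by rewrite scale0r addr0; exact: c2_is_derive_partial.
by apply: is_deriveB; apply: dH.
Qed.

Let dk0 v : dk v 0 = 0.
Proof. exact: (local_min_derive0 (is_derive_k v) (k_ge v)). Qed.

Lemma touching_grad : grad f x = grad u x.
Proof.
apply/rowP => i; rewrite !mxE; apply/eqP; rewrite -subr_eq0; apply/eqP.
rewrite -[RHS](dk0 (e i)) /dk scale0r addr0.
have pick g : \sum_j e i 0 j * partial j g x = partial i g x.
  rewrite (bigD1 i) //= mxE !eqxx mul1r big1 ?addr0 // => j ji.
  by rewrite mxE eqxx (negPf ji) mul0r.
by rewrite !pick.
Qed.

Lemma touching_hessian v :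
  (v *m hessian u x *m v^T) 0 0 <= (v *m hessian f x *m v^T) 0 0.
Proof.
rewrite -subr_ge0.
exact: (local_min_derive2_ge0 (is_derive_k v) (k_ge v) (is_derive_dk v)).
Qed.

End touching.

End directional_derivatives.

Lemma classical_viscosity_at (R : realType) n
    (Theta : 'rV[R]_n -> R -> 'rV[R]_n -> R) (u phi : 'rV[R]_n -> R) x :
  (\forall y \near x, c2_at u y) ->
  arctan_trace (hessian u x) = Theta x (u x) (grad u x) ->
  (\forall y \near x, c2_at phi y) -> phi x = u x ->
  ((\forall y \near x, u y <= phi y) ->
     Theta x (u x) (grad phi x) <= arctan_trace (hessian phi x)) /\
  ((\forall y \near x, phi y <= u y) ->
     arctan_trace (hessian phi x) <= Theta x (u x) (grad phi x)).
Proof.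
move=> u_c2 eq_u phi_c2 phi_u; have u_phi := esym phi_u.
split=> le_near.
  rewrite (touching_grad phi_c2 u_c2 phi_u le_near) -eq_u.
  apply: arctan_trace_mono; [exact: hessian_sym|exact: hessian_sym|].
  exact: touching_hessian.
(* Touching from below is touching from above with [u] and [phi] exchanged. *)
rewrite -(touching_grad u_c2 phi_c2 u_phi le_near) -eq_u.
apply: arctan_trace_mono; [exact: hessian_sym|exact: hessian_sym|].
exact: touching_hessian.
Qed.

Lemma near_eq_continuous (T U : topologicalType) (F G : T -> U) (x : T) :
  (\forall y \near x, F y = G y) -> {for x, continuous F} ->
  {for x, continuous G}.
Proof.
move=> FG; rewrite /prop_for /continuous_at -(nbhs_singleton FG).
move=> cF; apply: cvg_trans cF; apply: near_eq_cvg.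
exact: filterS FG.
Qed.

(** * Sums of functions of one coordinate *)

Section separable.
Variables (R : realType) (n : nat) (g g1 g2 : 'I_n -> R -> R) (D : 'I_n -> set R).
Hypotheses (D_open : forall i, open (D i))
  (g_g1 : forall i s, D i s -> is_derive s 1 (g i) (g1 i s))
  (g1_g2 : forall i s, D i s -> is_derive s 1 (g1 i) (g2 i s))
  (g2_cont : forall i s, D i s -> {for s, continuous (g2 i)}).

(** One open domain per coordinate, so that the first coordinate can be kept away from a singularity
    while the others remain free. *)
Let box : set 'rV[R]_n := [set x | forall i, D i (x 0 i)].

Local Notation e i := (delta_mx 0 i : 'rV[R]_n).
Implicit Types x : 'rV[R]_n.

Definition separable_sum x : R := \sum_i g i (x 0 i).

Lemma is_derive_coord (G : R -> R) x i j (l : R) :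
  is_derive (x 0 j) 1 G l ->
  is_derive x (e i) (fun y => G (y 0 j)) (if i == j then l else 0).
Proof.
move=> dG; have [->|ij] := eqVneq i j; last first.
  have E : (fun h : R => h^-1 *: (G ((h *: e i + x) 0 j) - G (x 0 j))) = cst 0.
    apply/funext => h; rewrite !mxE [j == i]eq_sym (negPf ij) andbF mulr0 add0r.
    by rewrite subrr scaler0.
  by apply: is_derive_cvg; rewrite E; exact: cvg_cst.
apply: is_derive_cvg.
have E : (fun h : R => h^-1 *: (G ((h *: e j + x) 0 j) - G (x 0 j))) =
    (fun h : R => h^-1 *: (G (h *: 1 + x 0 j) - G (x 0 j))).
  by apply/funext => h; rewrite !mxE !eqxx.
by rewrite E; case: dG => dG <-; exact: dG.
Qed.

Lemma near_box x : box x -> \forall y \near x, box y.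
Proof.
move=> bx.
apply: (@filter_forall _ _ (fun i => [set y : 'rV[R]_n | D i (y 0 i)]) (nbhs x) _) => i.
apply: (coord_continuous (i := 0) (j := i) (x := x)).
by apply: open_nbhs_nbhs; split; [exact: D_open|exact: bx].
Qed.

Lemma is_derive_separable x i : box x ->
  is_derive x (e i) separable_sum (g1 i (x 0 i)).
Proof.
move=> bx.
have -> : separable_sum = \sum_j (fun y : 'rV[R]_n => g j (y 0 j)).
  by apply/funext => y; rewrite fct_sumE.
apply: (is_derive_eq (is_derive_sum (fun j => is_derive_coord i (g_g1 (bx j))))).
by rewrite -big_mkcond /= (big_pred1 i) // => j; rewrite eq_sym.
Qed.

Lemma partial_separable x i : box x -> partial i separable_sum x = g1 i (x 0 i).
Proof. by move=> /(is_derive_separable i)[]. Qed.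

Lemma is_derive2_separable x i j : box x ->
  is_derive x (e j) (partial i separable_sum)
    (if j == i then g2 i (x 0 i) else 0).
Proof.
move=> bx; apply: near_eq_is_derive (is_derive_coord j (g1_g2 (bx i))).
by apply: filterS (near_box bx) => y /partial_separable ->.
Qed.

Lemma partial2_separable x i j : box x ->
  partial j (partial i separable_sum) x = if j == i then g2 i (x 0 i) else 0.
Proof. by move=> /(is_derive2_separable i j)[]. Qed.

Lemma grad_separable x : box x -> grad separable_sum x = \row_i g1 i (x 0 i).
Proof. by move=> bx; apply/rowP => i; rewrite !mxE partial_separable. Qed.

Lemma hessian_separable x : box x ->
  hessian separable_sum x = diag_mx (\row_i g2 i (x 0 i)).
Proof.
move=> bx; apply/matrixP => i j; rewrite !mxE partial2_separable // eq_sym.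
by case: eqVneq => [->|_]; rewrite ?mulr1n ?mulr0n.
Qed.

Lemma differentiable_separable x : box x -> differentiable separable_sum x.
Proof.
move=> bx.
have -> : separable_sum = \sum_j (fun y : 'rV[R]_n => g j (y 0 j)).
  by apply/funext => y; rewrite fct_sumE.
apply: differentiable_sum => i.
apply: (@differentiable_comp _ _ _ _ (fun y : 'rV[R]_n => y 0 i) (g i)).
  exact: differentiable_coord.
by apply/derivable1_diffP; case: (g_g1 (bx i)).
Qed.

Lemma continuous_coord_comp (G : R -> R) x i : {for x 0 i, continuous G} ->
  {for x, continuous (fun y : 'rV[R]_n => G (y 0 i))}.
Proof.
move=> cG; apply: (@continuous_comp _ _ _ (fun y : 'rV[R]_n => y 0 i) G) => //.
exact: coord_continuous.
Qed.

Lemma c2_separable x : box x -> c2_at separable_sum x.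
Proof.
move=> bx; split.
- exact/differentiable_continuous/differentiable_separable.
- move=> i; split; first by case: (is_derive_separable i bx).
  apply: (@near_eq_continuous _ _ (fun y : 'rV[R]_n => g1 i (y 0 i))).
    by apply: filterS (near_box bx) => y /partial_separable ->.
  apply: continuous_coord_comp; apply/differentiable_continuous/derivable1_diffP.
  by case: (g1_g2 (bx i)).
- move=> i j; split; first by case: (is_derive2_separable i j bx).
  apply: (@near_eq_continuous _ _
    (fun y : 'rV[R]_n => if j == i then g2 i (y 0 i) else 0)).
    by apply: filterS (near_box bx) => y /partial2_separable ->.
  case: eqP => _; last exact: cst_continuous.
  by apply: continuous_coord_comp; exact: g2_cont.
Qed.

Lemma arctan_trace_separable x : box x ->
  arctan_trace (hessian separable_sum x) = \sum_i atan (g2 i (x 0 i)).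
Proof.
move=> bx; rewrite hessian_separable // arctan_trace_diag.
by apply: eq_bigr => i _; rewrite mxE.
Qed.

End separable.

(** * The singular profile *)

Section exponents.
Variables (R : realType) (m : nat) (q : R).
Hypothesis hq : 2 * m%:R + 3 < q.

Let q1 : 0 < q - 1.
Proof. by have := ler0n R m; move: hq; lra. Qed.

Lemma oneB_expo : 1 - expo m q = (2 * m%:R + 2) / (q - 1).
Proof. by rewrite /expo; field; rewrite gt_eqF. Qed.

Lemma expo_itv : 0 < expo m q < 1.
Proof.
have := hq; have := ler0n R m.
move=> m0 mq; apply/andP; split; last by rewrite -subr_gt0 oneB_expo divr_gt0 //; lra.
by rewrite /expo divr_gt0 //; lra.
Qed.

End exponents.

Section power_functions.
Variable R : realType.
Implicit Types (b s t : R).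

(** Since [t = t^(1-b) t^b], it suffices that [t^(1-b)] tends to 0. This inequality carries every
    use of the vertical tangent: the absence of touching functions, of a Lipschitz constant, and the
    subcritical phase. *)
Lemma powR_superlinear (L b : R) : b < 1 -> \forall t \near 0^'+, L * t < t `^ b.
Proof.
move=> b1; have L1 : 0 < `|L| + 1 by rewrite ltr_wpDl.
have := @powR_cvg0 R (1 - b); rewrite subr_gt0 => /(_ b1)/cvgr0Pnorm_lt.
move=> /(_ (`|L| + 1)^-1); rewrite invr_gt0 => /(_ L1) H.
near=> t; have t0 : 0 < t by near: t; exact: nbhs_right_gt.
have : `|t `^ (1 - b)| < (`|L| + 1)^-1 by near: t.
rewrite gtr0_norm ?powR_gt0 // -[X in _ < X]mulr1 ltr_pdivlMl // => tb.
have tE : t = t `^ (1 - b) * t `^ b.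
  by rewrite -powRD ?subrK ?powRr1 ?ltW // (gt_eqF t0) implybT.
have tb0 : 0 < t `^ b by rewrite powR_gt0.
rewrite [X in L * X]tE mulrA gtr_pMl // (le_lt_trans _ tb) //.
by rewrite ler_wpM2r ?powR_ge0 // (le_trans (ler_norm L)) // lerDl.
Unshelve. all: by end_near.
Qed.

Lemma is_derive_powR_norm b s : s != 0 ->
  is_derive s 1 (fun t : R => `|t| `^ b) (b * Num.sg s * `|s| `^ (b - 1)).
Proof.
move=> s0; have [sneg|spos|/eqP] := ltrgtP s 0; last by rewrite (negPf s0).
- have Ns : 0 < - s by rewrite oppr_gt0.
  have d : is_derive s 1 (fun t : R => (- t) `^ b) (b * (- s) `^ (b - 1) * - 1).
    exact: (is_derive1_comp (is_derive1_powR b Ns) (is_deriveNid s 1)).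
  rewrite ltr0_sg // ltr0_norm // mulrAC; apply: near_eq_is_derive d.
  near=> t; rewrite /= ltr0_norm //; near: t; exact: lt_nbhsl.
- rewrite gtr0_sg // gtr0_norm // mulr1.
  apply: near_eq_is_derive (is_derive1_powR b spos).
  near=> t; rewrite /= gtr0_norm //; near: t; exact: lt_nbhsr.
Unshelve. all: by end_near.
Qed.

Lemma near_sg s : s != 0 -> \forall t \near s, Num.sg t = Num.sg s.
Proof.
move=> s0; have [sneg|spos|/eqP] := ltrgtP s 0; last by rewrite (negPf s0).
  near=> t; rewrite !ltr0_sg //; near: t; exact: lt_nbhsl.
near=> t; rewrite !gtr0_sg //; near: t; exact: lt_nbhsr.
Unshelve. all: by end_near.
Qed.

End power_functions.

(** * Adding quadratic terms to a solution of the profile equation *)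

Section quadratic_perturbation.
Variables (R : realType) (n : nat) (i1 : 'I_n) (m : nat) (q : R).
Variables (Theta1 : R -> R -> R) (a : 'I_n -> R).
Hypothesis hTheta1 : forall x1 p1 : R, 0 < p1 -> Theta1 x1 p1 = phase1 m q x1 p1.

Implicit Types (x : 'rV[R]_n) (phi : 'rV[R]_n -> R).

(** [example_fun] is the case [V = profile m q]; a free [V] lets the singular solution and its
    smooth approximations share all computations. *)
Definition quadratic_ext (V : R -> R) (x : 'rV[R]_n) : R :=
  V (x 0 i1) + \sum_(i < n | i != i1) a i * x 0 i ^+ 2 / 2.

Section profile_equation.
Variables (V V1 V2 : R -> R) (D : set R).
Hypotheses (D_open : open D)
  (V_V1 : forall s, D s -> is_derive s 1 V (V1 s))
  (V1_V2 : forall s, D s -> is_derive s 1 V1 (V2 s))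
  (V2_cont : forall s, D s -> {for s, continuous V2}).

Let g i := if i == i1 then V else fun s => a i * s ^+ 2 / 2.
Let g1 i := if i == i1 then V1 else fun s => a i * s.
Let g2 i := if i == i1 then V2 else fun=> a i.
Let Di i := if i == i1 then D else setT.

Let Di_open i : open (Di i).
Proof. by rewrite /Di; case: eqP => // _; exact: openT. Qed.

Let g_g1 i s : Di i s -> is_derive s 1 (g i) (g1 i s).
Proof.
rewrite /Di /g /g1; case: eqP => [_|_ _]; first exact: V_V1.
have -> : (fun s => a i * s ^+ 2 / 2) = (fun s => a i / 2 * s ^+ 2).
  by apply/funext => t; rewrite mulrAC.
by apply: is_derive_eq; rewrite /GRing.scale /=; field.
Qed.

Let g1_g2 i s : Di i s -> is_derive s 1 (g1 i) (g2 i s).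
Proof.
rewrite /Di /g1 /g2; case: eqP => [_|_ _]; first exact: V1_V2.
by apply: is_derive_eq; rewrite /GRing.scale /= mulr1.
Qed.

Let g2_cont i s : Di i s -> {for s, continuous (g2 i)}.
Proof.
rewrite /Di /g2; case: eqP => [_|_ _]; first exact: V2_cont.
exact: cst_continuous.
Qed.

Let quadratic_extE : quadratic_ext V = separable_sum g.
Proof.
apply/funext => x; rewrite /separable_sum (bigD1 i1) //= /g eqxx.
by congr (_ + _); apply: eq_bigr => i /negPf ->.
Qed.

Let in_box (x : 'rV[R]_n) : D (x 0 i1) -> forall i, Di i (x 0 i).
Proof. by move=> Dx i; rewrite /Di; case: eqP => // ->. Qed.

Lemma c2_quadratic_ext x : D (x 0 i1) -> c2_at (quadratic_ext V) x.
Proof.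
move=> /in_box Dx; rewrite quadratic_extE.
exact: (c2_separable Di_open g_g1 g1_g2 g2_cont).
Qed.

Lemma differentiable_quadratic_ext x :
  D (x 0 i1) -> differentiable (quadratic_ext V) x.
Proof.
by move=> /in_box Dx; rewrite quadratic_extE; exact: (differentiable_separable g_g1).
Qed.

Lemma grad_quadratic_ext x : D (x 0 i1) ->
  grad (quadratic_ext V) x 0 i1 = V1 (x 0 i1).
Proof.
move=> /in_box Dx; rewrite quadratic_extE (grad_separable g_g1) //.
by rewrite mxE /g1 eqxx.
Qed.

Lemma arctan_trace_quadratic_ext x : D (x 0 i1) ->
  arctan_trace (hessian (quadratic_ext V) x) =
  atan (V2 (x 0 i1)) + \sum_(i < n | i != i1) atan (a i).
Proof.
move=> /in_box Dx; rewrite quadratic_extE.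
rewrite (arctan_trace_separable Di_open g_g1 g1_g2) //.
rewrite (bigD1 i1) //= /g2 eqxx; congr (_ + _).
by apply: eq_bigr => i /negPf ->.
Qed.

Hypotheses (V1_gt0 : forall s, D s -> 0 < V1 s)
  (ode : forall s, D s -> V2 s =
    - ((1 - expo m q) * expo m q `^ (1 - q) * s ^+ (2 * m + 1) * V1 s `^ q)).

(** Positivity of [V1] allows [Theta1] to be replaced by [phase1]; oddness of [atan] and the ODE
    then turn the phase into [atan V2]. *)
Lemma total_phase_quadratic_ext x z : D (x 0 i1) ->
  total_phase i1 Theta1 a x z (grad (quadratic_ext V) x) =
  atan (V2 (x 0 i1)) + \sum_(i < n | i != i1) atan (a i).
Proof.
move=> Dx; rewrite /total_phase grad_quadratic_ext // hTheta1 ?V1_gt0 //.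
by rewrite /phase1 -atanN -ode.
Qed.

Lemma viscosity_quadratic_ext x phi : D (x 0 i1) ->
  let u := quadratic_ext V in let Theta := total_phase i1 Theta1 a in
  (\forall y \near x, c2_at phi y) -> phi x = u x ->
  ((\forall y \near x, u y <= phi y) ->
     Theta x (u x) (grad phi x) <= arctan_trace (hessian phi x)) /\
  ((\forall y \near x, phi y <= u y) ->
     arctan_trace (hessian phi x) <= Theta x (u x) (grad phi x)).
Proof.
move=> Dx u Theta; apply: classical_viscosity_at.
  have : nbhs x [set y : 'rV[R]_n | D (y 0 i1)].
    apply: (coord_continuous (i := 0) (j := i1) (x := x)).
    by apply: open_nbhs_nbhs; split.
  by apply: filterS => y; exact: c2_quadratic_ext.
by rewrite arctan_trace_quadratic_ext // /Theta total_phase_quadratic_ext.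
Qed.

End profile_equation.
End quadratic_perturbation.

Section profile.
Variables (R : realType) (m : nat) (q : R).
Hypothesis hq : 2 * m%:R + 3 < q.
Implicit Types (s t d : R).

Local Notation al := (expo m q).

Let al0 : 0 < al. Proof. by have /andP[] := expo_itv hq. Qed.
Let q1 : 0 < q - 1.
Proof. by have := ler0n R m; move: hq; lra. Qed.

Definition profile1 s := al * `|s| `^ (al - 1).
Definition profile2 s := al * ((al - 1) * Num.sg s * `|s| `^ (al - 2)).

Lemma profile1_gt0 s : s != 0 -> 0 < profile1 s.
Proof. by move=> s0; rewrite mulr_gt0 // powR_gt0 // normr_gt0. Qed.

Lemma is_derive_profile s : s != 0 -> is_derive s 1 (profile m q) (profile1 s).
Proof.
move=> s0.
have d : is_derive s 1 (fun t => Num.sg s * `|t| `^ al)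
    (Num.sg s * (al * Num.sg s * `|s| `^ (al - 1))).
  by apply: is_deriveZ; exact: is_derive_powR_norm.
have -> : profile1 s = Num.sg s * (al * Num.sg s * `|s| `^ (al - 1)).
  transitivity (Num.sg s ^+ 2 * profile1 s); first by rewrite sqr_sg s0 mul1r.
  by rewrite /profile1; ring.
apply: near_eq_is_derive d.
by apply: filterS (near_sg s0) => t; rewrite /profile => ->.
Qed.

Lemma is_derive_profile1 s : s != 0 -> is_derive s 1 profile1 (profile2 s).
Proof.
move=> s0; rewrite /profile2 (_ : al - 2 = al - 1 - 1); last by ring.
by apply: is_deriveZ; exact: is_derive_powR_norm.
Qed.

Lemma continuous_profile2 s : s != 0 -> {for s, continuous profile2}.
Proof.
move=> s0.
apply: (@near_eq_continuous _ _
  (fun t : R => al * ((al - 1) * Num.sg s * `|t| `^ (al - 2)))).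
  by apply: filterS (near_sg s0) => t; rewrite /profile2 => ->.
have [d _] := is_derive_powR_norm (al - 2) s0.
have c : {for s, continuous (fun t : R => `|t| `^ (al - 2))}.
  exact/differentiable_continuous/derivable1_diffP.
by apply: cvgMr; apply: cvgMr.
Qed.

(** The powers of [|s|] agree by the choice of [al], the signs because [2m+1] is odd, and the
    constants because [al^(1-q) al^q = al]. *)
Lemma profile_ode s : s != 0 -> profile2 s =
  - ((1 - al) * al `^ (1 - q) * s ^+ (2 * m + 1) * profile1 s `^ q).
Proof.
move=> s0; have s1 : 0 < `|s| by rewrite normr_gt0.
rewrite /profile2 /profile1 powRM ?powR_ge0 ?(ltW al0) // -powRrM.
have -> : s ^+ (2 * m + 1) = Num.sg s * `|s| `^ (2 * m + 1)%:R.
  rewrite powR_mulrn // addn1 !exprS mulrA -numEsg; congr (_ * _).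
  by rewrite !exprM !real_normK ?num_real.
have alq : al `^ (1 - q) * al `^ q = al.
  by rewrite -powRD ?(gt_eqF al0) ?implybT // subrK powRr1 // ltW.
have -> : al - 2 = (2 * m + 1)%:R + (al - 1) * q.
  rewrite /expo natrD natrM; field; by rewrite gt_eqF.
rewrite powRD ?(gt_eqF s1) ?implybT //.
by rewrite -{1}alq; ring.
Qed.

Lemma profile0 : profile m q 0 = 0.
Proof. by rewrite /profile sgr0 mul0r. Qed.

Lemma normr_profile s : `|profile m q s| = `|s| `^ al.
Proof.
have [->|s0] := eqVneq s 0; first by rewrite profile0 !normr0 powR0 // gt_eqF.
by rewrite /profile normrM normr_sg s0 mul1r ger0_norm // powR_ge0.
Qed.

Lemma continuous_profile : continuous (profile m q).
Proof.
move=> s; have [->|s0] := eqVneq s 0; last first.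
  apply/differentiable_continuous/derivable1_diffP.
  by case: (is_derive_profile s0).
rewrite /continuous_at profile0; apply/cvgr0Pnorm_lt => eps eps0.
suff : \forall t \near (0 : R), `|profile m q t| < eps by [].
apply/near_ballP; exists (eps `^ al^-1); first by rewrite powR_gt0.
move=> t; rewrite subr0 normr_profile => /(gt0_ltr_powR al0).
rewrite -powRrM mulVf ?gt_eqF // powRr1 ?ltW //.
by apply; rewrite nnegrE ?powR_ge0.
Qed.

End profile.

(** * Smooth profiles *)

(** Integrating from [- r] rather than from 0 gives a two-sided derivative at points of either sign;
    subtracting [G 0] restores the normalization at 0. *)
Lemma ex_primitive (R : realType) (f : R -> R) (r : R) : 0 < r -> continuous f ->
  exists2 F : R -> R, F 0 = 0 &
    forall s, s \in `]- r, r[ -> is_derive s 1 F (f s).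
Proof.
move=> r0 cf; pose G (s : R) := (\int[lebesgue_measure]_(t in `[- r, s]) f t)%R.
exists (fun s => G s - G 0); first by rewrite subrr.
move=> s; rewrite in_itv/= => /andP[rs sr].
have fi : lebesgue_measure.-integrable `[- r, r] (EFin \o f).
  apply: continuous_compact_integrable; first exact: segment_compact.
  by apply: continuous_subspaceT => t; exact: cf.
have [dG G'] := continuous_FTC1_closed sr fi rs (cf s).
have {}dG : is_derive s 1 G (f s) by split; rewrite -?derive1E.
by rewrite -[f s]subr0; apply: is_deriveB.
Qed.

Section smooth_slopes.
Variables (R : realType) (m : nat) (q d : R).
Hypotheses (hq : 2 * m%:R + 3 < q) (d0 : 0 < d).
Implicit Types (s t : R).

Local Notation al := (expo m q).

Let al0 : 0 < al. Proof. by have /andP[] := expo_itv hq. Qed.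
Let q1 : 0 < q - 1.
Proof. by have := ler0n R m; move: hq; lra. Qed.

Let A0 : 0 < al `^ (1 - q). Proof. exact: powR_gt0. Qed.

(* [slope1 ^ (1 - q) = base]; the singular profile is the case [d = 0]. *)
Let base s := al `^ (1 - q) * s ^+ (2 * m + 2) + d.
Definition slope1 s := base s `^ (- (q - 1)^-1).
Definition slope2 s := - (q - 1)^-1 * base s `^ (- (q - 1)^-1 - 1) *
  (al `^ (1 - q) * ((2 * m + 2)%:R * s ^+ (2 * m + 1))).

(** As [2m+2] is even, [base] stays above [d] for negative [s] too, so the smooth slopes are
    positive on the whole line. *)
Let even_pow s : s ^+ (2 * m + 2) = `|s| ^+ (2 * m + 2).
Proof. by rewrite -mulnSr !exprM real_normK ?num_real. Qed.

Let base_gt0 s : 0 < base s.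
Proof. by rewrite ltr_wpDl // mulr_ge0 ?powR_ge0 // even_pow exprn_ge0. Qed.

Lemma slope1_gt0 s : 0 < slope1 s.
Proof. exact: powR_gt0. Qed.

Lemma slope1_0 : slope1 0 = d `^ (- (q - 1)^-1).
Proof. by rewrite /slope1 /base addn2 expr0n mulr0 add0r. Qed.

Let is_derive_base s :
  is_derive s 1 base (al `^ (1 - q) * ((2 * m + 2)%:R * s ^+ (2 * m + 1))).
Proof.
have dX : is_derive s 1 (fun t : R => t ^+ (2 * m + 2))
    ((2 * m + 2)%:R * s ^+ (2 * m + 1)).
  split; first exact: exprn_derivable.
  by rewrite exp_derive addn2 addn1 [LHS]mulr1.
apply: is_derive_eq
  (is_deriveD (is_deriveZ (al `^ (1 - q)) dX) (is_derive_cst d s 1)) _.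
by rewrite addr0.
Qed.

Lemma is_derive_slope1 s : is_derive s 1 slope1 (slope2 s).
Proof.
exact: (is_derive1_comp (is_derive1_powR _ (base_gt0 s)) (is_derive_base s)).
Qed.

Lemma continuous_slope1 : continuous slope1.
Proof.
move=> s; apply/differentiable_continuous/derivable1_diffP.
by case: (is_derive_slope1 s).
Qed.

Lemma continuous_slope2 : continuous slope2.
Proof.
move=> s.
have base_cont : {for s, continuous (fun t => base t `^ (- (q - 1)^-1 - 1))}.
  apply/differentiable_continuous/derivable1_diffP.
  by case: (is_derive1_comp (is_derive1_powR (- (q - 1)^-1 - 1) (base_gt0 s))
    (is_derive_base s)).
have X_cont : {for s, continuous (fun t : R => t ^+ (2 * m + 1))}.
  exact: exprn_continuous.
apply: (@cvgM _ _ (nbhs s) _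
  (fun t : R => - (q - 1)^-1 * base t `^ (- (q - 1)^-1 - 1))
  (fun t : R => al `^ (1 - q) * ((2 * m + 2)%:R * t ^+ (2 * m + 1)))).
  exact: cvgMr.
by apply: cvgMr; exact: cvgMr.
Qed.

(** The chain rule leaves [base] to the power [-q/(q-1)], which is [slope1^q], and the coefficient
    [(2m+2)/(q-1)] equals [1 - al]. *)
Lemma slope_ode s : slope2 s =
  - ((1 - al) * al `^ (1 - q) * s ^+ (2 * m + 1) * slope1 s `^ q).
Proof.
rewrite /slope2 /slope1 -powRrM.
have -> : - (q - 1)^-1 - 1 = - (q - 1)^-1 * q by field; rewrite gt_eqF.
rewrite (oneB_expo hq) natrD natrM; field; by rewrite gt_eqF.
Qed.

(** Adding [d] raises the base of a negative power. For [d = 0] the formula gives [profile1],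
    because [(2m+2)/(q-1) = 1 - al]. *)
Lemma slope1_le_profile1 s : s != 0 -> slope1 s <= profile1 m q s.
Proof.
move=> s0; have s1 : 0 < `|s| by rewrite normr_gt0.
rewrite /slope1 powRN.
have -> : profile1 m q s = ((al `^ (1 - q) * s ^+ (2 * m + 2)) `^ (q - 1)^-1)^-1.
  rewrite -powRN powRM ?powR_ge0 // even_pow; last exact: exprn_ge0.
  rewrite -powRrM -powR_mulrn // -powRrM /profile1; congr (_ * _ `^ _).
    rewrite (_ : (1 - q) * - (q - 1)^-1 = 1) ?powRr1 ?ltW //.
    by field; rewrite gt_eqF.
  rewrite -[al - 1]opprB (oneB_expo hq) natrD natrM; field; by rewrite gt_eqF.
have b0 : 0 < al `^ (1 - q) * s ^+ (2 * m + 2).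
  by rewrite even_pow mulr_gt0 // exprn_gt0.
rewrite lef_pV2 ?posrE ?powR_gt0 // ge0_ler_powR ?nnegrE ?invr_ge0 ?ltW //.
by rewrite ltrDl.
Qed.

End smooth_slopes.

Lemma is_derive_ge0_le (R : realType) (f f1 : R -> R) (x y : R) : x <= y ->
  (forall t, t \in `]x, y[ -> is_derive t 1 f (f1 t)) ->
  (forall t, t \in `]x, y[ -> 0 <= f1 t) ->
  {within `[x, y], continuous f} -> f x <= f y.
Proof.
rewrite le_eqVlt => /predU1P[->//|xy] df f1_ge0 cf.
have [t txy E] := MVT xy df cf.
by rewrite -subr_ge0 E mulr_ge0 ?f1_ge0 // subr_ge0 ltW.
Qed.

Lemma is_derive_lipschitz_at0 (R : realType) (k : R -> R) (l : R) :
  is_derive (0 : R) 1 k l ->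
  \forall h \near (0 : R), `|k h - k 0| <= (`|l| + 1) * `|h|.
Proof.
move=> dk.
have : h^-1 *: (k (h *: 1 + 0) - k 0) @[h --> 0^'] --> l.
  by case: dk => dk <-; exact: dk.
move=> /cvgrPdist_lt/(_ 1 ltr01); rewrite near_withinE; apply: filterS => h H.
have [->|h0] := eqVneq h 0; first by rewrite subrr !normr0 mulr0.
have := H h0; rewrite [_ *: 1]mulr1 addr0 => {}H.
have -> : k h - k 0 = h * (h^-1 *: (k h - k 0)).
  by rewrite [_ *: _]mulrC mulrCA divff ?mulr1.
rewrite normrM mulrC ler_wpM2r //.
rewrite -[X in `|X|](subrK l) addrC (le_trans (ler_normD _ _)) // lerD2l.
by rewrite distrC ltW.
Qed.

Section profile_touching.
Variables (R : realType) (m : nat) (q : R).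
Hypothesis hq : 2 * m%:R + 3 < q.

Let al1 : expo m q < 1. Proof. by have /andP[] := expo_itv hq. Qed.

Lemma profile_gt0E (t : R) : 0 < t -> profile m q t = t `^ expo m q.
Proof. by move=> t0; rewrite /profile gtr0_sg // mul1r gtr0_norm. Qed.

Lemma profileN (t : R) : profile m q (- t) = - profile m q t.
Proof. by rewrite /profile sgrN normrN mulNr. Qed.

(** Differentiability gives [|k t - k 0| <= L |t|], which [t^al] exceeds for small [t > 0]. Touching
    from above fails at [t]; by oddness of the profile, touching from below fails at [- t]. *)
Lemma no_touching_at0 (k : R -> R) : derivable k 0 1 ->
  ~ (\forall t \near (0 : R), profile m q t <= k t - k 0) /\
  ~ (\forall t \near (0 : R), k t - k 0 <= profile m q t).
Proof.
move=> /derivableP/is_derive_lipschitz_at0; set L := _ + 1 => kL.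
have pick (P : R -> Prop) : (\forall t \near (0 : R), P t) ->
    exists t : R, [/\ 0 < t, L * t < t `^ expo m q, P t & P (- t)].
  move=> /near_ballP[r r0 rP].
  have [t [[Lt t0] tr]] := filter_ex (filterI (filterI
    (powR_superlinear L al1) (nbhs_right_gt (0 : R))) (nbhs_right_lt r0)).
  exists t; split=> //; apply: rP; rewrite subr0 ?normrN gtr0_norm //.
split=> /(filterI kL)/pick[t [t0 Lt [kt pt] [kNt pNt]]].
  move: kt pt Lt => /=; rewrite (gtr0_norm t0) profile_gt0E // ler_norml => /andP[_ kt].
  by lra.
move: kNt pNt Lt => /=; rewrite normrN (gtr0_norm t0) profileN profile_gt0E //.
by rewrite ler_norml => /andP[kNt _]; lra.
Qed.

End profile_touching.

Section smooth_approximation.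
Variables (R : realType) (m : nat) (q d : R).
Hypotheses (hq : 2 * m%:R + 3 < q) (d0 : 0 < d).
Variable F : R -> R.
Hypotheses (F0 : F 0 = 0)
  (dF : forall s : R, s \in `](- 2), 2[ -> is_derive s 1 F (slope1 m q d s)).

(** Both [F] and [profile m q - F] are nondecreasing and vanish at 0, so [F] lies between 0 and the
    profile, which is at most 1 in absolute value. The bound is uniform in [d]. *)
Lemma primitive_slope1_bounded s : `|s| < 1 -> `|F s| <= 1.
Proof.
move=> s1.
(* The interval stays on one side of 0, where the profile has no derivative; 0 may be an endpoint,
   since only continuity is needed there. *)
have mono (x y : R) : -1 < x -> y < 1 -> x <= y -> (0 <= x) || (y <= 0) ->
    F x <= F y /\ profile m q x - F x <= profile m q y - F y.
  move=> x1 y1 xy xy0.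
  have in2 (t : R) : t \in `[x, y] -> t \in `](- 2), 2[.
    rewrite !in_itv/= => /andP[xt ty]; apply/andP; split; lra.
  have in2' (t : R) : t \in `]x, y[ -> t \in `](- 2), 2[.
    by move=> txy; apply: in2; exact: subset_itv_oo_cc.
  have tN0 (t : R) : t \in `]x, y[ -> t != 0.
    rewrite in_itv/= => /andP[xt ty].
    by case/orP: xy0 => ?; [rewrite gt_eqF|rewrite lt_eqF] => //; lra.
  have cF : {within `[x, y], continuous F}.
    by apply: derivable_within_continuous => t /in2/dF[].
  split.
    have F1_ge0 t : t \in `]x, y[ -> 0 <= slope1 m q d t.
      by rewrite ltW // slope1_gt0.
    have dF' t : t \in `]x, y[ -> is_derive t 1 F (slope1 m q d t).
      by move=> /in2'; exact: dF.
    exact: is_derive_ge0_le xy dF' F1_ge0 cF.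
  pose W t := profile m q t - F t.
  have dW t : t \in `]x, y[ -> is_derive t 1 W (profile1 m q t - slope1 m q d t).
    move=> txy; have dp := is_derive_profile m q (tN0 _ txy).
    have dFt := dF (in2' _ txy); exact: is_deriveB.
  have W1_ge0 t : t \in `]x, y[ -> 0 <= profile1 m q t - slope1 m q d t.
    by move=> /tN0 t0; rewrite subr_ge0 slope1_le_profile1.
  have cW : {within `[x, y], continuous W}.
    move=> t; apply: cvgB; last exact: cF.
    by apply: continuous_subspaceT => z; exact: continuous_profile.
  exact: is_derive_ge0_le xy dW W1_ge0 cW.
have p1 : `|profile m q s| <= 1.
  rewrite normr_profile // (_ : 1 = 1 `^ expo m q); last by rewrite powR1.
  have /andP[al0 _] := expo_itv hq.
  by rewrite ge0_ler_powR ?nnegrE // ltW.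
move: s1 p1; rewrite ltr_norml !ler_norml => /andP[Ns s1] /andP[Np p1].
have W0 : profile m q 0 - F 0 = 0 by rewrite profile0 F0 subrr.
have [s0|s0] := leP 0 s.
  have [||||] := mono 0 s; rewrite ?lexx ?W0 ?F0 //; lra.
have [||||] := mono s 0; rewrite ?lexx ?orbT ?W0 ?F0 //; lra.
Qed.

End smooth_approximation.

(** * The example *)

Section euclidean_norm.
Variables (R : realType) (n : nat).
Implicit Types x : 'rV[R]_n.

Lemma ler_coord_enorm x i : `|x 0 i| <= enorm x.
Proof.
rewrite /enorm -sqrtr_sqr ler_wsqrtr // (bigD1 i) //= lerDl.
by apply: sumr_ge0 => j _; exact: sqr_ge0.
Qed.

Lemma enorm_delta (t : R) (i : 'I_n) : enorm (t *: delta_mx 0 i) = `|t|.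
Proof.
rewrite /enorm (bigD1 i) //= big1 ?addr0.
  by rewrite !mxE !eqxx mulr1 sqrtr_sqr.
by move=> j ji; rewrite !mxE (negPf ji) andbF mulr0 expr0n.
Qed.

End euclidean_norm.

Section example.
Variables (R : realType) (n : nat) (i1 : 'I_n) (m : nat) (q : R).
Variables (Theta1 : R -> R -> R) (a : 'I_n -> R).
Hypotheses (hq : 2 * m%:R + 3 < q)
  (hTheta1 : forall x1 p1 : R, 0 < p1 -> Theta1 x1 p1 = phase1 m q x1 p1).
Implicit Types (x y : 'rV[R]_n) (V : R -> R).

Local Notation u := (example_fun i1 m q a).
Local Notation Theta := (total_phase i1 Theta1 a).
Local Notation e1 := (delta_mx 0 i1 : 'rV[R]_n).

Let D : set R := [set s | s != 0].

Let D_open : open D. Proof. exact: open_neq. Qed.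

Lemma quadratic_ext_split V x :
  quadratic_ext i1 a V x = V (x 0 i1) + quadratic_ext i1 a (cst 0) x.
Proof. by rewrite /quadratic_ext /= add0r. Qed.

Lemma quadratic_ext_line V x (t : R) : x 0 i1 = 0 ->
  quadratic_ext i1 a V (x + t *: e1) - quadratic_ext i1 a V x = V t - V 0.
Proof.
move=> x0; rewrite /quadratic_ext !mxE !eqxx x0 mulr1 add0r.
have -> : \sum_(i < n | i != i1) a i * (x + t *: e1) 0 i ^+ 2 / 2 =
    \sum_(i < n | i != i1) a i * x 0 i ^+ 2 / 2.
  by apply: eq_bigr => i ii1; rewrite !mxE (negPf ii1) andbF mulr0 addr0.
by rewrite opprD addrACA subrr addr0.
Qed.

(** The quadratic part, which is the extension of the zero profile, is split off so that continuity
    of [V] suffices: the singular profile is not differentiable at 0. *)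
Lemma continuous_quadratic_ext V : continuous V ->
  continuous (quadratic_ext i1 a V).
Proof.
move=> cV x.
rewrite (_ : quadratic_ext i1 a V =
  (fun y : 'rV[R]_n => V (y 0 i1)) \+ quadratic_ext i1 a (cst 0)); last first.
  by apply/funext => y; exact: quadratic_ext_split.
have V_cont : {for x, continuous (fun y : 'rV[R]_n => V (y 0 i1))}.
  by apply: continuous_coord_comp; exact: cV.
have quad_cont : {for x, continuous (quadratic_ext i1 a (cst 0))}.
  apply: differentiable_continuous.
  by apply: (@differentiable_quadratic_ext _ _ i1 a (cst 0) (cst 0) setT).
exact: cvgD V_cont quad_cont.
Qed.

(** Along [e1] the quadratic terms are constant, so a touching function would restrict to one
    touching the profile at 0. *)
Lemma example_no_touching x phi : x 0 i1 = 0 -> derivable phi x e1 ->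
  phi x = u x ->
  ~ (\forall y \near x, u y <= phi y) /\ ~ (\forall y \near x, phi y <= u y).
Proof.
move=> x0 dphi phi_u.
pose k (t : R) := phi (x + t *: e1).
have k0 : k 0 = u x by rewrite /k scale0r addr0.
have uE t : u (x + t *: e1) = profile m q t + u x.
  have := quadratic_ext_line (profile m q) t x0; rewrite profile0 subr0.
  by move=> <-; rewrite subrK.
have dk : derivable k 0 1.
  have [] // : is_derive (0 : R) 1 k ('D_e1 phi x).
  by apply: is_derive_line; rewrite scale0r addr0; exact: derivableP.
have [no_above no_below] := no_touching_at0 hq dk.
split=> /(near_along_line e1) H; [apply: no_above|apply: no_below];
  apply: filterS H => t; rewrite uE k0 /k.
  by rewrite lerBrDr.
by rewrite lerBlDr.
Qed.

Lemma example_viscosity_solution : viscosity_solution Theta (slab i1) u.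
Proof.
split=> [x _|x _ phi phi_c2 phi_u].
  exact: (continuous_quadratic_ext (continuous_profile hq)).
have [x0|x0] := eqVneq (x 0 i1) 0.
  have [_ /(_ i1)[dphi _] _] := nbhs_singleton phi_c2.
  by have [no_above no_below] := example_no_touching x0 dphi phi_u; split.
exact: (viscosity_quadratic_ext hTheta1 D_open (is_derive_profile m q)
  (is_derive_profile1 m q) (@continuous_profile2 _ m q) (profile1_gt0 hq)
  (profile_ode hq) x0 phi_c2 phi_u).
Qed.

Lemma example_not_lipschitz (r : R) : 0 < r ->
  ~ [lipschitz u x | x in slab i1 `&` eball r].
Proof.
move=> r0 lip.
(* The Lipschitz property is a statement about all large constants; one of them is extracted. Its
   sign is unknown, hence [|M|] below. *)
have [M HM] : exists M : R, forall p,
    ((slab i1 `&` eball r) `*` (slab i1 `&` eball r)) p ->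
    `|u p.1 - u p.2| <= M * `|p.1 - p.2|.
  exact: (@filter_ex _ (pinfty_nbhs R) _ _ lip).
have /andP[al0 al1] := expo_itv hq.
have [t [[[Lt t0] tr] t1]] := filter_ex (filterI (filterI (filterI
  (powR_superlinear `|M| al1) (nbhs_right_gt (0 : R))) (nbhs_right_lt r0))
  (nbhs_right_lt (ltr01 : 0 < 1 :> R))).
have inA (s : R) : 0 <= s -> s <= t -> (slab i1 `&` eball r) (s *: e1).
  move=> s0 st; split; rewrite /slab /eball /= ?enorm_delta ?mxE ?eqxx ?mulr1.
    by rewrite ger0_norm // (le_lt_trans st).
  by rewrite ger0_norm // (le_lt_trans st).
have := HM (t *: e1, 0 *: e1)
  (conj (inA _ (ltW t0) (lexx _)) (inA _ (lexx _) (ltW t0))).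
rewrite /= scale0r subr0.
have := quadratic_ext_line (profile m q) t (mxE _ _ _ _ : (0 : 'rV[R]_n) 0 i1 = 0).
rewrite add0r profile0 subr0 => ->; rewrite profile_gt0E // => H.
move: H; rewrite normrZ (gtr0_norm t0) (gtr0_norm (powR_gt0 _ t0)) leNgt.
move/negP; apply; apply: le_lt_trans Lt.
have te0 : 0 <= t * `|e1| by rewrite mulr_ge0 // ltW.
rewrite (le_trans (ler_wpM2r te0 (ler_norm M))) // ler_wpM2l // ler_piMr ?(ltW t0) //.
exact: norm_delta_le1.
Qed.

Lemma example_subcritical : (2 <= n)%N -> exists x,
  [/\ slab i1 x, x 0 i1 != 0, differentiable u x
    & Theta x (u x) (grad u x) < (n%:R - 2) * (pi / 2)].
Proof.
move=> n2; have /andP[al0 al1] := expo_itv hq.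
have pi2 : 0 < pi / 2 :> R by rewrite divr_gt0 // pi_gt0.
pose S := \sum_(i < n | i != i1) atan (a i).
have S_lt : S < (n%:R - 1) * (pi / 2).
  have <- : \sum_(i < n | i != i1) (pi / 2) = (n%:R - 1) * (pi / 2) :> R.
    have : \sum_(i < n) (pi / 2) = n%:R * (pi / 2) :> R.
      by rewrite sumr_const card_ord mulr_natl.
    by rewrite (bigD1 i1) //= mulrBl mul1r => <-; rewrite [RHS]addrC addKr.
  (* Strictness requires an index other than [i1], which exists because [2 <= n]. *)
  apply: ltr_sum => [|i _]; last exact: atan_ltpi2.
  have [j ji1] : exists j : 'I_n, j != i1.
    case: (posnP (val i1)) => i10.
      by exists (Ordinal n2); apply/eqP => /(congr1 val); rewrite /= i10.
    exists (Ordinal (ltnW n2)); apply/eqP => /(congr1 val) /= i10'.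
    by move: i10; rewrite /= -i10'.
  by apply/hasP; exists j; rewrite ?mem_index_enum.
(* An upper target for [atan v'']: by [S_lt] it exceeds [- pi / 2], and the minimum with 0 keeps it
   below [pi / 2], so that [atan (tan y) = y]. *)
pose y := Num.min 0 ((n%:R - 2) * (pi / 2) - S).
have y_itv : y \in `](- (pi / 2)), (pi / 2)[.
  rewrite in_itv/= lt_min gt_min oppr_lt0 pi2 /=; lra.
(* For [0 < t < 1], [L t < t^al] gives [L < t^al / t^2]. As [v''(t) = - al (1 - al) t^al / t^2],
   this choice of [L] yields [v''(t) < - |tan y| <= tan y]. *)
pose L := `|tan y| / (expo m q * (1 - expo m q)).
have c0 : 0 < expo m q * (1 - expo m q) by rewrite mulr_gt0 // subr_gt0.
have [t [[Lt t0] t1]] := filter_ex (filterI (filterI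
  (powR_superlinear L al1) (nbhs_right_gt (0 : R)))
  (nbhs_right_lt (ltr01 : 0 < 1 :> R))).
have tn0 : t != 0 by rewrite gt_eqF.
have xt : (t *: e1) 0 i1 = t by rewrite !mxE !eqxx mulr1.
exists (t *: e1); split.
- by rewrite /slab /= xt gtr0_norm.
- by rewrite xt.
- apply: (differentiable_quadratic_ext a (is_derive_profile m q)).
  by rewrite /D xt.
rewrite (total_phase_quadratic_ext a hTheta1 (is_derive_profile m q)
  (profile1_gt0 hq) (profile_ode hq)) xt //.
rewrite -/S -ltrBrDr; apply: (@lt_le_trans _ _ y); last by rewrite ge_min lexx orbT.
rewrite -[ltRHS](tanK y_itv); apply: lt_atan.
have t2 : 0 < t ^+ 2 by rewrite exprn_gt0.
have E : profile2 m q t = - (expo m q * (1 - expo m q)) * (t `^ expo m q / t ^+ 2).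
  rewrite /profile2 gtr0_sg // gtr0_norm // powRB ?(negPf tn0) ?implybT //.
  by rewrite powR_mulrn ?ltW //; ring.
rewrite E mulNr ltrNl.
have : L < t `^ expo m q / t ^+ 2.
  rewrite ltr_pdivlMr //; apply: le_lt_trans Lt; rewrite expr2 mulrA.
  have L0 : 0 <= L by apply: divr_ge0 => //; exact: ltW.
  by rewrite ler_piMr ?(ltW t1) //; exact: mulr_ge0 L0 (ltW t0).
rewrite -(ltr_pM2l c0); apply: le_lt_trans.
by rewrite /L mulrC divfK ?gt_eqF // -normrN ler_norm.
Qed.

End example.

(** The point [x] excludes the infinite values taken on an empty set. The oscillation is then a real
    number, and the estimate becomes an inequality in [R]. *)
Lemma osc_bounded (R : realType) n (A : set 'rV[R]_n) (w : 'rV[R]_n -> R)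
    (x : 'rV[R]_n) (K : R) : A x -> (forall y, A y -> `|w y| <= K) ->
  exists2 r : R, osc A w = r%:E & 0 <= r <= 2 * K.
Proof.
move=> Ax wK; rewrite /osc; set S := [set (w y)%:E | y in A].
have Sx : S (w x)%:E by exists x.
have sup_le : (ereal_sup S <= K%:E)%E.
  apply: ge_ereal_sup => _ [y Ay <-]; rewrite lee_fin.
  by have := wK _ Ay; rewrite ler_norml => /andP[].
have inf_ge : ((- K)%:E <= ereal_inf S)%E.
  apply: le_ereal_inf_tmp => _ [y Ay <-]; rewrite lee_fin.
  by have := wK _ Ay; rewrite ler_norml => /andP[].
have le_sup := ereal_sup_ubound Sx; have inf_le := ereal_inf_lbound Sx.
move: sup_le le_sup inf_ge inf_le.
case: (ereal_sup S) => [s| |] //=; case: (ereal_inf S) => [i| |] //=.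
rewrite !lee_fin => sK ws iK iw; exists (s - i) => //; lra.
Qed.

(** * Failure of the interior gradient estimate *)

Section gradient_estimate.
Variables (R : realType) (n : nat) (i1 : 'I_n) (m : nat) (q : R).
Variables (Theta1 : R -> R -> R) (a : 'I_n -> R).
Hypotheses (hq : 2 * m%:R + 3 < q)
  (hTheta1 : forall x1 p1 : R, 0 < p1 -> Theta1 x1 p1 = phase1 m q x1 p1).

Local Notation Theta := (total_phase i1 Theta1 a).

Let D : set R := [set` `](- 2), 2[].

Let D_open : open D. Proof. exact: itv_open. Qed.

(** On the unit ball [F] contributes at most 1 and each quadratic term at most [|a i|], whatever [d]
    is. *)
Let bound := 1 + \sum_(i < n | i != i1) `|a i|.

Lemma smooth_solution (d : R) : 0 < d -> exists w : 'rV[R]_n -> R,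
  [/\ forall x, eball 1 x -> c2_at w x, viscosity_solution Theta (eball 1) w,
      forall x, eball 1 x -> `|w x| <= bound
    & grad w 0 0 i1 = d `^ (- (q - 1)^-1)].
Proof.
move=> d0.
have [F F0 dF] := ex_primitive (ltr0Sn R 1) (@continuous_slope1 R m q d d0).
have dF1 s : D s -> is_derive s 1 (slope1 m q d) (slope2 m q d s).
  by move=> _; exact: is_derive_slope1.
have cF2 s : D s -> {for s, continuous (slope2 m q d)}.
  by move=> _; exact: continuous_slope2.
have F1_gt0 s : D s -> 0 < slope1 m q d s by move=> _; exact: slope1_gt0.
have ode s : D s -> slope2 m q d s = - ((1 - expo m q) * expo m q `^ (1 - q) *
    s ^+ (2 * m + 1) * slope1 m q d s `^ q).
  by move=> _; exact: slope_ode.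
have coord_lt1 (x : 'rV[R]_n) i : eball 1 x -> `|x 0 i| < 1.
  exact: le_lt_trans (ler_coord_enorm x i).
have ball_D (x : 'rV[R]_n) : eball 1 x -> D (x 0 i1).
  move=> /(coord_lt1 _ i1); rewrite /D /= in_itv/= ltr_norml => /andP[? ?].
  by apply/andP; split; lra.
have w_c2 (x : 'rV[R]_n) : eball 1 x -> c2_at (quadratic_ext i1 a F) x.
  by move=> /ball_D Dx; exact: (c2_quadratic_ext a D_open dF dF1 cF2 Dx).
exists (quadratic_ext i1 a F); split=> //.
- split=> [x /w_c2[]//|x /ball_D Dx phi phi_c2 phi_w].
  exact: (viscosity_quadratic_ext hTheta1 D_open dF dF1 cF2 F1_gt0 ode Dx phi_c2 phi_w).
- move=> x bx; rewrite /quadratic_ext (le_trans (ler_normD _ _)) // lerD //.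
    exact: (primitive_slope1_bounded hq d0 F0 dF (coord_lt1 _ _ bx)).
  rewrite (le_trans (ler_norm_sum _ _ _)) //; apply: ler_sum => i _.
  have := coord_lt1 _ i bx; rewrite ltr_norml => /andP[xN1 x1].
  rewrite -mulrA normrM ler_piMr // ger0_norm ?divr_ge0 ?sqr_ge0 //.
  by rewrite ler_pdivrMr // mul1r; nra.
- rewrite (grad_quadratic_ext a dF) mxE; first by rewrite slope1_0.
  by rewrite /D /= in_itv/=; apply/andP; split; lra.
Qed.

Lemma no_interior_gradient_estimate :
  ~ exists C : R, interior_gradient_estimate Theta C.
Proof.
move=> [C est].
have q1 : 0 < q - 1 by have := ler0n R m; move: hq; lra.
have bound0 : 0 <= bound by rewrite addr_ge0 // sumr_ge0.
(* Since the oscillation is at most [2 * bound], [B] dominates the right-hand side of the estimate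
   for all smooth solutions at once; [|C|] covers a negative [C]. *)
pose B := `|C| * (1 + (2 * bound) ^+ 2).
have B0 : 0 <= B by rewrite mulr_ge0 // addr_ge0 // sqr_ge0.
have B1 : 0 < B + 1 by rewrite ltr_wpDl.
(* With [d = (B + 1)^(1-q)] the slope [d^(-1/(q-1))] at the origin is exactly [B + 1]. *)
have [w [w_c2 w_visc w_bound grad_w]] := smooth_solution (powR_gt0 (1 - q) B1).
have ball0 : eball 1 (0 : 'rV[R]_n).
  rewrite /eball /enorm /= big1 ?sqrtr0 // => i _.
  by rewrite mxE expr0n.
have [r osc_w /andP[r0 r_le]] := osc_bounded ball0 w_bound.
have := est w w_c2 w_visc; rewrite osc_w -EFin_expe -EFinD -EFinM lee_fin.
apply/negP; rewrite -ltNge.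
have grad_ge : B + 1 <= enorm (grad w 0).
  apply: le_trans (ler_coord_enorm _ i1); rewrite grad_w -powRrM.
  rewrite (_ : _ * _ = 1) ?powRr1 ?(ltW B1) ?ler_norm //.
  by field; rewrite gt_eqF.
apply: lt_le_trans grad_ge; apply: (@le_lt_trans _ _ B); last by rewrite ltrDl.
rewrite (le_trans (ler_wpM2r _ (ler_norm C))) ?addr_ge0 ?sqr_ge0 //.
rewrite ler_wpM2l // lerD2l; apply: lerXn2r => //; rewrite nnegrE //.
by rewrite mulr_ge0.
Qed.

End gradient_estimate.

Theorem mainTheorem11 (R : realType) (n : nat) (hn : (2 <= n)%N)
  (m : nat) (q : R) (hq : 2 * m%:R + 3 < q)
  (Theta1 : R -> R -> R)
  (hTheta1 : forall x1 p1 : R, 0 < p1 -> Theta1 x1 p1 = phase1 m q x1 p1)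
  (a : 'I_n -> R) :
  let i1 := idx1 hn in
  let u := example_fun i1 m q a in
  let Theta := total_phase i1 Theta1 a in
  [/\ 0 < expo m q < 1,
      viscosity_solution Theta (slab i1) u,
      forall r : R, 0 < r -> ~ [lipschitz u x | x in slab i1 `&` eball r],
      exists x : 'rV[R]_n,
        [/\ slab i1 x, x 0 i1 != 0, differentiable u x
          & Theta x (u x) (grad u x) < (n%:R - 2) * (pi / 2)]
    & ~ exists C : R, interior_gradient_estimate Theta C].
Proof.
split.
- exact: expo_itv.
- exact: example_viscosity_solution.
- by move=> r; exact: example_not_lipschitz.
- exact: example_subcritical.
- exact (@no_interior_gradient_estimate R n (idx1 hn) m q Theta1 a hq hTheta1).
Qed.
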